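(* Let $\mathcal{T}$ be a rooted tree (locally finite, without leaves) such that $$D_{min}(\mathcal{T})\ge 2 \quad\text{and}\quad \sup_{n\in \mathbb{N}} \frac{ \log D_{max}^{(n)}(\mathcal{T})}{ \log D_{min}^{(n)}(\mathcal{T})}<\infty$$ and let $\alpha = (\alpha_k)_{k=1}^\infty$ be a sequence of non-negative numbers with $\sum_{k=1}^\infty \alpha_k^2<\infty$. Then the following conditions are equivalent: (1) $M^*(\mathcal{T}, \alpha)$ is almost surely bounded (i.e. $M^*(\mathcal{T},\alpha)<\infty$ almost surely); (2) the following convergence holds: $$\lim_{N\rightarrow\infty}\mathbb{E}\Big[\sup_{n\geq N}\sup_{m\geq 0}\sup_{\xi\in\partial\mathcal{T}}\Big|\sum_{k=n}^{n+m}\alpha_kZ(\pi_k(\xi))\Big|^2\Big]=0;$$ (3) almost surely, the series $\sum_{k=1}^\infty \alpha_k Z(\pi_k(\xi))$ converges uniformly in $\xi \in \partial \mathcal{T}$; (4) the sequence $\alpha$ satisfies $$\sum_{l=0}^\infty \Big(\sum_{k=l+1}^\infty \alpha_k^2\Big)^{1/2} \cdot \frac{\log D_{max}^{(l+1)}(\mathcal{T})}{\big(\log \big[\prod_{i=1}^{l+1}D_{max}^{(i)}(\mathcal{T})\big]\big)^{1/2}}<\infty.$$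
   Context: $\mathbb{N}=\{1,2,\dots\}$. All rooted trees $\mathcal{T}$ are assumed locally finite and without leaves. The root is denoted $\rho$, $d(\cdot,\cdot)$ is the graph distance, $|v|=d(\rho,v)$, and $\preccurlyeq$ is the natural partial order ($u\preccurlyeq v$ iff $u$ lies on the geodesic from $\rho$ to $v$). For $v\in\mathcal{T}$, $D(v)=\#\{u\in \mathcal{T}: v\preccurlyeq u \text{ and } d(u,v)=1\}$ is the number of children of $v$. Set $D_{min}(\mathcal{T})=\inf_{v\in\mathcal{T}}D(v)$ and, for $n\in\mathbb{N}$, $$D_{min}^{(n)}(\mathcal{T})=\min_{v\in\mathcal{T},\,|v|=n-1}D(v),\qquad D_{max}^{(n)}(\mathcal{T})=\max_{v\in\mathcal{T},\,|v|=n-1}D(v).$$ A rooted geodesic ray is a sequence $\xi=(\rho,v_1,v_2,\dots)$ of vertices with $v_1\preccurlyeq v_2\preccurlyeq\cdots$ and consecutive vertices at distance 1 (so $|v_n|=n$). The boundary $\partial\mathcal{T}$ is the set of all rooted geodesic rays, and $\pi_n(\xi)=v_n$ for $n\in\mathbb{N}$. $(Z(v))_{v\in\mathcal{T}}$ is a family of independent standard Gaussian $N(0,1)$ random variables, and $M^*(\mathcal{T},\alpha)=\sup_{n\in\mathbb{N}}\sup_{\xi\in\partial\mathcal{T}}\big|\sum_{k=1}^n\alpha_kZ(\pi_k(\xi))\big|$. *)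

(* Defs.v *)
From HB Require Import structures.
From mathcomp Require Import all_boot all_order all_algebra finmap.
From mathcomp Require Import all_classical all_reals all_analysis.

Set Implicit Arguments.
Unset Strict Implicit.
Unset Printing Implicit Defensive.

Import Order.TTheory GRing.Theory Num.Theory.
Import numFieldNormedType.Exports.

Local Open Scope classical_set_scope.
Local Open Scope ring_scope.

(* A tree is a connected simple graph without cycles; [tree_acyclic] says that
   a cyclic sequence of pairwise distinct, consecutively adjacent vertices has
   at most two vertices (for two adjacent vertices [:: u; v] is such a
   sequence). *)
Record rooted_tree := RootedTree {
  vertex :> choiceType;
  root : vertex;
  adj : rel vertex;
  adj_sym : symmetric adj;
  adj_irrefl : irreflexive adj;
  tree_connected : forall u v : vertex,
    exists p : seq vertex, path adj u p /\ last u p = v;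
  tree_acyclic : forall c : seq vertex, ucycle adj c -> (size c <= 2)%N
}.
Arguments root : clear implicits.

Section Tree.
Variable T : rooted_tree.
Implicit Types (u v : T) (n : nat).

Definition walk_of_length u v n : Prop :=
  exists p : seq T, [/\ path (@adj T) u p, last u p = v & size p = n].

Fact walk_exists u v : exists n, `[< walk_of_length u v n >].
Proof.
have [p [up pv]] := tree_connected u v.
by exists (size p); apply/asboolP; exists p.
Qed.

Definition dist u v : nat := ex_minn (walk_exists u v).

Definition depth v : nat := dist (root T) v.

(* u lies on the geodesic from the root to v *)
Definition ancestor u v : Prop :=
  exists p : seq T, [/\ path (@adj T) (root T) p, last (root T) p = v,
    size p = dist (root T) v & u \in root T :: p].

Definition children v : set T := [set u | ancestor v u /\ dist u v = 1%N].

Definition locally_finite : Prop :=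
  forall v, finite_set [set u | adj v u].

Definition no_leaves : Prop := forall v, children v !=set0.

(* [fset_set] of an infinite set is empty, so this is the number of children
   only for a locally finite tree. *)
Definition nchildren v : nat := #|` fset_set (children v)|.

Definition level n : set T := [set v | depth v = n].

(* Rays are indexed from 0, with [xi 0] the root, so that pi_n(xi) = xi n. *)
Definition boundary : set (nat -> T) :=
  [set xi | xi 0%N = root T /\
    forall n, ancestor (xi n) (xi n.+1) /\ dist (xi n) (xi n.+1) = 1%N].

End Tree.
Arguments level : clear implicits.
Arguments boundary : clear implicits.

Section Degrees.
Context {R : realType}.
Variable T : rooted_tree.

Definition Dmin : R := inf [set (nchildren v)%:R | v in [set: T]].

(* In a locally finite tree without leaves every level is finite and nonempty,
   so that the infimum and the supremum below are a minimum and a maximum;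
   both are meant for n >= 1. *)
Definition Dmin_at (n : nat) : R :=
  inf [set (nchildren v)%:R | v in level T n.-1].

Definition Dmax_at (n : nat) : R :=
  sup [set (nchildren v)%:R | v in level T n.-1].

End Degrees.
Arguments Dmin : clear implicits.
Arguments Dmin_at : clear implicits.
Arguments Dmax_at : clear implicits.

Section Gaussian.
Context {d : measure_display} {Omega : measurableType d} {R : realType}.
Variable P : probability Omega R.

Definition mutually_independent (I : choiceType) (X : I -> {RV P >-> R}) :
    Prop :=
  forall (J : {fset I}) (B : I -> set R),
    (forall i, measurable (B i)) ->
    P (\bigcap_(i in [set` J]) (X i @^-1` B i)) =
    (\prod_(i <- J) P (X i @^-1` B i))%E.

Definition standard_gaussian (X : {RV P >-> R}) : Prop :=
  forall B : set R, measurable B -> distribution P X B = normal_prob 0 1 B.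

Variable T : rooted_tree.
Variables (alpha : nat -> R) (Z : T -> {RV P >-> R}).

(* \sum_(m <= k < n) : the upper bound n is excluded *)
Definition ray_sum (m n : nat) (xi : nat -> T) (w : Omega) : R :=
  \sum_(m <= k < n) alpha k * Z (xi k) w.

Definition Mstar (w : Omega) : \bar R :=
  ereal_sup [set ereal_sup [set `|ray_sum 1 n.+1 xi w|%:E
                               | xi in boundary T]
                | n in [set n : nat | (1 <= n)%N]].

Definition tail_sup (N : nat) (w : Omega) : \bar R :=
  ereal_sup [set ereal_sup [set ereal_sup
               [set (`|ray_sum n (n + m).+1 xi w| ^+ 2)%:E
                   | xi in boundary T]
               | m in [set: nat]]
             | n in [set n : nat | (N <= n)%N]].

Definition converges_uniformly_on_boundary (w : Omega) : Prop :=
  exists S : (nat -> T) -> R,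
    {uniform boundary T, (fun n xi => ray_sum 1 n.+1 xi w) @ \oo --> S}.

End Gaussian.

Section Condition4.
Context {R : realType}.
Variables (T : rooted_tree) (alpha : nat -> R).

Definition tail_norm (l : nat) : R :=
  Num.sqrt (limn (fun n => \sum_(l.+1 <= k < n) alpha k ^+ 2)).

Definition entropy_term (l : nat) : R :=
  tail_norm l * (ln (Dmax_at R T l.+1) /
    Num.sqrt (ln (\prod_(1 <= i < l.+2) Dmax_at R T i))).

End Condition4.

(* Main.v *)
Require Import Defs.
From HB Require Import structures.
From mathcomp Require Import all_boot all_order all_algebra finmap.
From mathcomp Require Import all_classical all_reals all_analysis.
From mathcomp Require Import measurable_realfun ring lra.

Set Implicit Arguments.
Unset Strict Implicit.
Unset Printing Implicit Defensive.

Import Order.TTheory GRing.Theory Num.Theory.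
Import numFieldNormedType.Exports.

Local Open Scope classical_set_scope.
Local Open Scope ring_scope.

(** The four conditions are called (1) to (4), in the order of the statement.
    Write D_k for the largest number of children of a vertex of generation
    k - 1, L_n for the sum of the ln D_k with k <= n, s_n for the square root of
    L_n, and tau_k for the l2 norm of (alpha_j)_(j >= k).  Since L_k - L_(k-1) is
    ln D_k, the quotient ln D_k / s_k lies between s_k - s_(k-1) and twice that
    difference.  So condition (4) says that the sum of tau_k (s_k - s_(k-1)) is
    finite.  The independence and the normality of the Z(v) enter only through
    the Laplace transform of their linear combinations ([integral_expR_gauss]).

    (4) implies (2).  The sequence a_k = tau_k / s_k is non-increasing; let
    lambda_k = 1 / a_k.  Give a vertex v of generation n >= N the two weights

      exp (+- sum lambda_k alpha_k Z(v_k) - sum (lambda_k alpha_k)^2 / 2 - 2 L_n),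

    where k runs from N to n and v_k is the ancestor of v of generation k.  Each
    has mean exp (- 2 L_n), and generation n has at most exp (L_n) vertices, so
    the sum G of all the weights has a mean bounded independently of N.  A sum of
    lambda_k alpha_k Z(v_k) exceeds ln (1 + G) at most by the terms subtracted in
    the exponent.  As a_k is non-increasing, Abel summation turns these bounds,
    for all n at once, into a bound 3 r (1 + ln (1 + G)) for the sums of
    alpha_k Z(v_k), where r is s_N tau_N plus the tail of the series (4)
    ([chaining_bound]).  This r tends to 0 ([entropy_tail_small]), and the square
    of 1 + ln (1 + G) is at most 4 (1 + G).

    (1) implies (4).  Let K bound the ratios ln Dmax / ln Dmin, and let x satisfy
    x_1^2 + ... + x_m^2 <= L_m / (2 K) for all m <= n.  Spread a unit mass over
    generation n by dividing it equally among the children of each vertex, and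
    multiply the mass of v by exp (sum x_k Z(v_k) - sum x_k^2 / 2).  The total
    has mean 1.  Its second moment is bounded independently of n and x: two
    vertices whose paths separate after generation m contribute
    exp (x_1^2 + ... + x_m^2), and a vertex of generation m carries a mass of at
    most exp (- L_m / K).  The same reweighting shifts the mean of the sum of
    alpha_k Z(v_k) to the sum of x_k alpha_k.  If all these ray sums are at most
    A outside an event of small probability, then the sum of x_k alpha_k is
    bounded independently of n and x ([tilted_sum_le]).  Taking x_k proportional
    to alpha_k times the sum of the (s_j - s_(j-1)) / tau_j with j <= k gives (4):
    a discrete Hardy inequality shows that this x is admissible ([hardy_slope]),
    and the sum of x_k alpha_k is then, up to the factor and in the limit, the
    sum of tau_j (s_j - s_(j-1)) ([sum_slope]).

    (2) implies (3) by the Markov inequality.  (3) implies (1) because only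
    finitely many partial sums are not close to the limit, and each partial sum
    takes finitely many values on the boundary. *)

(** * Elementary estimates *)

Section Elementary.
Variable R : realType.

Lemma ln2_ge : 1 / 2 <= ln 2 :> R.
Proof.
rewrite -ler_expR lnK ?posrE// -[1/2]opprK expRN -[leRHS]invrK lef_pV2 ?posrE
  ?expR_gt0//.
by apply: le_trans (expR_ge1Dx _); lra.
Qed.

Lemma geometric_sum_le (q : R) n : 0 <= q -> q < 1 ->
  \sum_(0 <= k < n) q ^+ k <= (1 - q)^-1.
Proof.
move=> q0 q1; have q1' : 0 < 1 - q by rewrite subr_gt0.
suff H : \sum_(0 <= k < n) q ^+ k = (1 - q ^+ n) / (1 - q).
  by rewrite H ler_pdivrMr// mulVf ?gt_eqF// gerBl exprn_ge0.
elim: n => [|n IH]; first by rewrite big_nil expr0 subrr mul0r.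
rewrite big_nat_recr//= IH exprS; field; exact: lt0r_neq0.
Qed.

Lemma sum_expR_le (c : R) n : 0 < c ->
  \sum_(0 <= k < n) expR (- (c * k%:R)) <= (1 - expR (- c))^-1.
Proof.
move=> c0; have -> : \sum_(0 <= k < n) expR (- (c * k%:R)) = \sum_(0 <= k < n) expR (-
  c) ^+ k.
  by apply: eq_bigr => k _; rewrite -expRM_natr mulNr.
by apply: geometric_sum_le; rewrite ?expR_ge0// expR_lt1 oppr_lt0.
Qed.

(** With y = ln (1 + g), this is (1 + y / 2)^2 <= exp (y / 2)^2. *)
Lemma sqr_ln_le (g : R) : 0 <= g -> (1 + ln (1 + g)) ^+ 2 <= 4 * (1 + g).
Proof.
move=> g0; set y := ln (1 + g).
have y0 : 0 <= y by rewrite ln_ge0// lerDl.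
have -> : 1 + g = expR (y / 2) ^+ 2.
  by rewrite -expRM_natl mulrC divfK// /y lnK// posrE; lra.
have := expR_ge1Dx (y / 2); have := expR_ge0 (y / 2); nra.
Qed.

Lemma sum_delta (r : seq nat) (F : nat -> R) k : uniq r -> k \in r ->
  \sum_(l <- r) F l * (k == l)%:R = F k.
Proof.
move=> ur rk; rewrite (bigD1_seq k)//= eqxx mulr1 big1 ?addr0// => l.
by rewrite eq_sym => /negbTE ->; rewrite mulr0.
Qed.

Lemma cvge0P (u : nat -> \bar R) : (forall n, (0 <= u n)%E) ->
  u n @[n --> \oo] --> 0%E <->
  forall e : R, 0 < e -> exists N0, forall n, (N0 <= n)%N -> (u n <= e%:E)%E.
Proof.
move=> u0; split=> [/fine_cvgP[[N1 _ ufin] ucvg] e e0|small].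
  have [N2 _ ue] := (@cvgrPdist_le _ _ _ _ _ _ _).1 ucvg _ e0.
  exists (maxn N1 N2) => n; rewrite geq_max => /andP[n1 n2].
  have := ue n n2; rewrite /= sub0r normrN ger0_norm ?fine_ge0// => une.
  by rewrite -[u n]fineK ?lee_fin//; exact: ufin.
apply/fine_cvgP; split.
  have [N0 hN0] := small 1 ltr01; exists N0 => // n /hN0 un.
  by rewrite ge0_fin_numE//; apply: le_lt_trans un _; rewrite ltry.
apply/cvgrPdist_le => e e0; have [N0 hN0] := small e e0; exists N0 => // n /hN0 un.
rewrite /= sub0r normrN ger0_norm ?fine_ge0// -lee_fin fineK//.
by rewrite ge0_fin_numE//; apply: le_lt_trans un _; rewrite ltry.
Qed.

End Elementary.

(** * Integrals of nonnegative functions *)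

Section Integration.
Local Open Scope ereal_scope.

Section monotone.
Context d (T : measurableType d) (R : realType).
Variables (mu : {measure set T -> \bar R}) (f g : T -> \bar R).
Import HBNNSimple.

(** The integral is a supremum over simple functions, hence monotone even for
    functions not known to be measurable, such as a supremum over the boundary. *)
Lemma ge0_le_integralT : (forall x, 0 <= f x) -> (forall x, f x <= g x) ->
  \int[mu]_x f x <= \int[mu]_x g x.
Proof.
move=> f0 fg; have g0 x : 0 <= g x := le_trans (f0 x) (fg x).
rewrite !ge0_integralTE//; apply: ereal_sup_le => _ [h hf <-].
exists h => // x.
exact: le_trans (hf x) (fg x).
Qed.
End monotone.

Section density.
Context d d' (T : measurableType d) (Y : measurableType d') (R : realType).
Variables (mu : {measure set T -> \bar R}) (nu : {measure set Y -> \bar R}).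
Variables (X : T -> Y) (g : T -> R) (c : \bar R) (f : Y -> \bar R).
Hypotheses (mX : measurable_fun setT X) (mg : measurable_fun setT g).
Hypotheses (g0 : forall x, (0 <= g x)%R) (cfin : c \is a fin_num).
Hypothesis mu_nu : forall B, measurable B ->
  \int[mu]_x ((\1_B (X x))%:E * (g x)%:E) = c * nu B.
Hypotheses (mf : measurable_fun setT f) (f0 : forall y, 0 <= f y).

Let mge : measurable_fun setT (EFin \o g).
Proof. exact/measurable_EFinP. Qed.

Let mXB B : measurable B ->
  measurable_fun setT (EFin \o (fun x => \1_B (X x) : R)).
Proof.
move=> mB; apply/measurable_EFinP.
exact: (measurableT_comp (measurable_indic (R:=R) mB) mX).
Qed.

Import HBNNSimple.

(** The hypothesis [mu_nu] is the conclusion for indicator functions; it passes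
    to simple functions by linearity and to f by monotone convergence.  This
    covers both integration against a density and the extension of a product
    rule from events to functions. *)
Lemma integral_comp_density :
  \int[mu]_x (f (X x) * (g x)%:E) = c * \int[nu]_y f y.
Proof.
pose h := nnsfun_approx measurableT mf.
have h_nd y n m : (n <= m)%N -> (h n y)%:E <= (h m y)%:E.
  by move=> nm; rewrite lee_fin; exact/lefP/nd_nnsfun_approx.
have h_cvg y : (h n y)%:E @[n --> \oo] --> f y by exact: cvg_nnsfun_approx.
have hE n : \int[mu]_x ((h n (X x))%:E * (g x)%:E) = c * \int[nu]_y (h n y)%:E.
  have hdec y : (h n y)%:E =
      \sum_(r \in range (h n)) (r%:E * (\1_(h n @^-1` [set r]) y)%:E).
    by rewrite {1}fimfunE -fsumEFin.
  have ge0 r x : 0 <= r%:E * (\1_(h n @^-1` [set r]) (X x))%:E * (g x)%:E.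
    by rewrite mule_ge0// ?nnfun_muleindic_ge0// lee_fin.
  under eq_integral.
    move=> x _; rewrite hdec ge0_mule_fsuml; last first.
      by move=> r; exact: nnfun_muleindic_ge0.
    over.
  rewrite ge0_integral_fsum//; last first.
    move=> r; apply: emeasurable_funM => //; apply: emeasurable_funM => //.
    exact: mXB.
  rewrite integralT_nnsfun sintegralE ge0_mule_fsumr; last first.
    by move=> r; exact: nnsfun_mulemu_ge0.
  apply: eq_fsbigr => _ /set_mem [y _ <-].
  under eq_integral do rewrite -muleA.
  rewrite ge0_integralZl_EFin ?mu_nu// 1?muleCA//.
    by move=> x _; rewrite mule_ge0// lee_fin.
  by apply: emeasurable_funM => //; exact: mXB.
transitivity (limn (fun n => \int[mu]_x ((h n (X x))%:E * (g x)%:E))).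
  rewrite -monotone_convergence//=; first last.
  - by move=> x _ n m nm; rewrite lee_wpmul2r ?lee_fin//; exact: h_nd.
  - by move=> n x _; rewrite mule_ge0// lee_fin.
  - move=> n; apply: emeasurable_funM => //; apply/measurable_EFinP.
    exact: measurableT_comp.
  apply: eq_integral => x _; apply/esym/cvg_lim => //.
  exact: cvgeZr.
under eq_fun do rewrite hE.
apply/cvg_lim => //; apply: cvgeZl => //.
have -> : \int[nu]_y f y = \int[nu]_y limn (fun n => (h n y)%:E).
  by apply: eq_integral => y _; apply/esym/cvg_lim.
apply: cvg_monotone_convergence => //.
- by move=> n; exact/measurable_EFinP.
- by move=> n y _; rewrite lee_fin.
- by move=> y _ n m; exact: h_nd.
Qed.

End density.
End Integration.

(** * Exponential moments of independent Gaussians *)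

Section GaussianExponential.
Context d (Omega : measurableType d) (R : realType) (P : probability Omega R).
Context (I : choiceType) (Z : I -> {RV P >-> R}).
Hypotheses (Zindep : mutually_independent Z).
Hypothesis (Zgauss : forall i, standard_gaussian (Z i)).

(** Completing the square turns exp (c x) times the N(0,1) density into
    exp (c^2 / 2) times the N(c,1) density. *)
Lemma integral_expR_normal (c : R) :
  (\int[normal_prob 0 1]_x (expR (c * x))%:E = (expR (c ^+ 2 / 2))%:E)%E.
Proof.
have mexp : measurable_fun setT (fun x : R => (expR (c * x))%:E).
  by apply/measurable_EFinP; apply: (measurableT_comp (@measurable_expR R));
    exact: mulrl_measurable.
have H := @integral_comp_density _ _ _ _ R (@lebesgue_measure R)
  (normal_prob 0 1) idfun (normal_pdf 0 1) 1 (fun x => (expR (c * x))%:E).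
rewrite -[LHS]mul1e -H //; last 4 first.
- exact: measurable_id.
- exact: measurable_normal_pdf.
- by move=> x; exact: normal_pdf_ge0.
- move=> B mB; rewrite mul1e /normal_prob [RHS]integral_mkcond.
  apply: eq_integral => x _; rewrite patchE indicE /=.
  by case: ifP => _; rewrite ?mul1e ?mul0e.
under eq_integral.
  move=> x _; rewrite /= -EFinM.
  have -> : expR (c * x) * normal_pdf 0 1 x = expR (c ^+ 2 / 2) * normal_pdf c 1 x.
    rewrite !normal_pdfE ?oner_eq0// /normal_fun mulrCA [RHS]mulrCA -!expRD.
    by congr (_ * expR _); field.
  rewrite EFinM; over.
rewrite ge0_integralZl_EFin ?expR_ge0//; last 2 first.
- by move=> x _; rewrite lee_fin normal_pdf_ge0.
- by apply/measurable_EFinP; exact: measurable_normal_pdf.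
by rewrite integral_normal_pdf mule1.
Qed.

Let mZ i : measurable_fun setT (Z i).
Proof. exact: measurable_funPT. Qed.

Let cyl (J : {fset I}) (B : I -> set R) := \bigcap_(i in [set` J]) (Z i @^-1` B i).

Let mcyl J B : (forall i, measurable (B i)) -> measurable (cyl J B).
Proof.
move=> mB; apply: fin_bigcap_measurable => // i _.
by rewrite -[X in measurable X]setTI; exact: mZ.
Qed.

(** Independence is a product rule for events, so the exponential factors are
    removed one at a time: replacing exp (c u * Z u) by the indicator of an
    event about Z u enlarges the cylinder by one index, and the induction
    hypothesis applies. *)
Let integral_expR_cyl (c : I -> R) (s : seq I) (J : {fset I}) (B : I -> set R) :
  uniq s -> {in s, forall i, i \notin J} -> (forall i, measurable (B i)) ->
  (\int[P]_w ((expR (\sum_(i <- s) c i * Z i w))%:E * (\1_(cyl J B) w)%:E) =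
   (expR (\sum_(i <- s) c i ^+ 2 / 2))%:E * P (cyl J B))%E.
Proof.
elim: s J B => [|u s IH] J B /= us sJ mB.
  under eq_integral do rewrite big_nil expR0 mul1e.
  rewrite big_nil expR0 mul1e integral_indic ?setIT//; exact: mcyl.
have /andP[us' uniqs] := us.
have mexp : measurable_fun setT (fun x : R => (expR (c u * x))%:E).
  by apply/measurable_EFinP; apply: (measurableT_comp (@measurable_expR R));
    exact: mulrl_measurable.
pose g w := expR (\sum_(i <- s) c i * Z i w) * \1_(cyl J B) w.
transitivity (\int[P]_w ((expR (c u * Z u w))%:E * (g w)%:E))%E.
  apply: eq_integral => w _; rewrite big_cons expRD /g !EFinM muleA //.
rewrite (@integral_comp_density _ _ _ _ R P (normal_prob 0 1) (Z u) g
  ((expR (\sum_(i <- s) c i ^+ 2 / 2))%:E * P (cyl J B))%E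
  (fun x => (expR (c u * x))%:E)) //.
- rewrite integral_expR_normal big_cons expRD EFinM muleC muleA //.
- exact: mZ.
- rewrite /g; apply: measurable_funM; last exact: measurable_indic (mcyl _ _).
  apply: measurableT_comp => //; apply: measurable_sum => i.
  exact: measurable_funM.
- by move=> w; rewrite mulr_ge0 ?expR_ge0.
- by rewrite fin_numM// fin_num_measure//; exact: mcyl.
- move=> C mC; pose B' i := if i == u then C else B i.
  have mB' i : measurable (B' i).
    by rewrite /B'; case: ifP => _; [exact: mC|exact: mB].
  have uJ : u \notin J by apply: sJ; rewrite mem_head.
  have cylE : cyl (u |` J)%fset B' = Z u @^-1` C `&` cyl J B.
    apply/seteqP; split => [w H|w [wC wB] i].
      split=> [|i /= iJ].
        by have /= := H u; rewrite /B' eqxx; apply; rewrite !inE eqxx.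
      have /= := H i; rewrite /B'; case: eqP => [iu|_]; last first.
        by apply; rewrite !inE iJ orbT.
      by move: uJ; rewrite -iu iJ.
    rewrite /= !inE /B' => /orP[/eqP ->|iJ]; first by rewrite eqxx.
    by case: eqP => [->|_] //; exact: wB.
  transitivity (\int[P]_w ((expR (\sum_(i <- s) c i * Z i w))%:E *
      (\1_(cyl (u |` J)%fset B') w)%:E))%E.
    apply: eq_integral => w _; rewrite cylE indicI /g EFinM !EFinM muleCA.
    by rewrite !indicE /= .
  rewrite IH//; last first.
    move=> i si; rewrite !inE negb_or sJ ?inE ?si ?orbT// andbT.
    by apply: contraNN us' => /eqP <-.
  rewrite -muleA; congr (_ * _)%E.
  rewrite /cyl !Zindep// big_fsetU1//= muleC; congr (_ * _)%E.
    apply: eq_big_seq => i iJ; rewrite /B'; case: eqP => // iu.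
    by move: uJ; rewrite -iu iJ.
  by rewrite /B' eqxx -[LHS]/(distribution P (Z u) C) Zgauss.
Qed.

Lemma integral_expR_uniq (c : I -> R) (s : seq I) : uniq s ->
  (\int[P]_w (expR (\sum_(i <- s) c i * Z i w))%:E =
   (expR (\sum_(i <- s) c i ^+ 2 / 2))%:E)%E.
Proof.
move=> us; have := @integral_expR_cyl c s fset0 (fun=> setT) us.
have -> : cyl fset0 (fun=> setT) = setT.
  by apply/seteqP; split => // w _ i /=; rewrite inE.
rewrite probability_setT mule1 => <- //.
by apply: eq_integral => w _; rewrite indicT mule1.
Qed.

(** The indices v k may repeat; the double sum is the variance of the linear
    combination.  Grouping the coefficients by index reduces to distinct ones. *)
Lemma integral_expR_gauss (K : eqType) (r : seq K) (c : K -> R) (v : K -> I) :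
  (\int[P]_w (expR (\sum_(k <- r) c k * Z (v k) w))%:E =
   (expR ((\sum_(k <- r) \sum_(l <- r) c k * c l * (v k == v l)%:R) / 2))%:E)%E.
Proof.
pose s := undup (map v r).
pose b i := \sum_(k <- r) c k * (v k == i)%:R.
have bE (F : I -> R) : \sum_(i <- s) b i * F i = \sum_(k <- r) c k * F (v k).
  under eq_bigr do rewrite mulr_suml.
  rewrite exchange_big /=; apply: eq_big_seq => k rk.
  rewrite (bigD1_seq (v k)) ?undup_uniq ?mem_undup ?map_f//= eqxx mulr1.
  rewrite big1 ?addr0// => i /negbTE ik.
  by rewrite eq_sym ik mulr0 mul0r.
under eq_integral do rewrite -(bE (Z^~ _)).
rewrite integral_expR_uniq ?undup_uniq//; congr (expR _)%:E.
rewrite -mulr_suml; congr (_ / _).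
under eq_bigr do rewrite expr2.
rewrite bE; apply: eq_bigr => k _; rewrite mulr_sumr; apply: eq_bigr => l _.
by rewrite mulrA eq_sym.
Qed.

End GaussianExponential.

(** * Generations and rays of a rooted tree *)

Section TreeStructure.
Variable T : rooted_tree.
Implicit Types (u v w : T) (n : nat) (xi eta : nat -> T).

Lemma dist_walk u v : walk_of_length u v (dist u v).
Proof. by rewrite /dist; case: ex_minnP => n /asboolP nP _. Qed.

Lemma walk_dist u v n : walk_of_length u v n -> (dist u v <= n)%N.
Proof. by move=> uv; rewrite /dist; case: ex_minnP => m _ min; apply: min;
  apply/asboolP. Qed.

Lemma dist_triangle u v w : (dist u w <= dist u v + dist v w)%N.
Proof.
have [p [up pv sp]] := dist_walk u v; have [q [vq qw sq]] := dist_walk v w.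
by apply: walk_dist; exists (p ++ q); rewrite cat_path last_cat size_cat pv up vq sp sq.
Qed.

Lemma distC u v : dist u v = dist v u.
Proof.
suff H (a b : T) : (dist a b <= dist b a)%N by apply/eqP; rewrite eqn_leq !H.
have [p [bp pa sp]] := dist_walk b a.
apply: walk_dist; exists (rev (belast b p)); rewrite size_rev size_belast; split=> //.
  by rewrite -pa rev_path; rewrite (eq_path (e' := @adj T)) // => x y; exact: adj_sym.
by case: p bp pa sp => [_ <-|c p _ _ _] //; rewrite /= rev_cons last_rcons.
Qed.

Lemma distxx u : dist u u = 0%N.
Proof. by apply/eqP; rewrite -leqn0; apply: walk_dist; exists [::]. Qed.

Lemma dist1_adj u v : dist u v = 1%N -> adj u v.
Proof.
by move=> uv; have := dist_walk u v; rewrite uv => -[[|w [|? ?]] []]//=;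
  rewrite andbT => ? <-.
Qed.

Lemma depth_root : depth (Defs.root T) = 0%N. Proof. exact: distxx. Qed.

Lemma depth_eq0 v : depth v = 0%N -> v = Defs.root T.
Proof. by rewrite /depth => v0; have := dist_walk (Defs.root T) v;
  rewrite v0 => -[p [_ + /size0nil p0]]; rewrite p0. Qed.

Lemma childP v u : children v u <-> adj v u /\ depth u = (depth v).+1.
Proof.
split=> [[[p [pathp lastp sp vp]]]|[vu du]].
  rewrite distC => vu.
  split; first exact: (dist1_adj vu).
  apply/eqP; rewrite eqn_leq -addn1 -{1}vu dist_triangle andTb /depth -sp.
  case/splitPl: vp pathp lastp sp => p1 p2 l1; rewrite cat_path last_cat l1.
  move=> /andP[path1 path2] l2 _; rewrite size_cat -vu leq_add//.
    by apply: walk_dist; exists p1.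
  by apply: walk_dist; exists p2.
split; last rewrite distC.
  have [p [rp pv sp]] := dist_walk (Defs.root T) v.
  exists (rcons p u);
    rewrite rcons_path last_rcons size_rcons pv rp vu -/(depth u) du sp.
  by split => //; rewrite -rcons_cons mem_rcons inE -pv mem_last orbT.
have : (dist v u <= 1)%N by apply: walk_dist; exists [:: u]; rewrite /= vu.
have := leq_trans (dist_triangle (Defs.root T) v u) (leqnn _).
rewrite -/(depth u) -/(depth v) du -addn1 leq_add2l => ? ?.
by apply/eqP; rewrite eqn_leq; apply/andP.
Qed.

Lemma parent_exists n u : depth u = n.+1 -> exists2 v, depth v = n & children v u.
Proof.
rewrite /depth => du; have := dist_walk (Defs.root T) u; rewrite du => -[p []].
case/lastP: p => [//|p w]; rewrite rcons_path last_rcons size_rcons.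
move=> /andP[rp pw] wu [sp]; rewrite {w}wu in pw.
set v := last (Defs.root T) p in pw.
have dv : (depth v <= n)%N by apply: walk_dist; exists p.
have vn : depth v = n.
  apply/eqP; rewrite eqn_leq dv /= -ltnS -du.
  apply: leq_trans (dist_triangle _ v _) _.
  by rewrite -addn1 leq_add2l; apply: walk_dist; exists [:: u]; rewrite /= pw.
by exists v => //; apply/childP; split; [exact: pw|rewrite vn; exact: du].
Qed.

(** Climbing from v and w to their parents and repeating yields a path that
    stays at or above their generation; a common child would close it into a
    cycle. *)
Lemma same_depth_path n v w : depth v = n -> depth w = n -> v != w ->
  exists p, [/\ path (@adj T) v p, last v p = w, uniq (v :: p)
              & {in v :: p, forall u, depth u <= n}%N].
Proof.
elim: n v w => [|n IH] v w dv dw vw.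
  by move: vw; rewrite (depth_eq0 dv) (depth_eq0 dw) eqxx.
have [a da /childP[av _]] := parent_exists dv.
have [b db /childP[bw _]] := parent_exists dw.
have ne (x y : T) k : depth x = k -> depth y = k.+1 -> x != y.
  by move=> dx dy; apply: contra_eq_neq dx => ->; rewrite dy gtn_eqF.
have [ab|ab] := eqVneq a b.
  exists [:: a; w]; rewrite /= adj_sym av ab bw !inE negb_or.
  rewrite eq_sym -ab (ne _ _ _ da dv) vw (ne _ _ _ da dw); split=> // u.
  by rewrite !inE => /or3P[] /eqP ->; rewrite ?dv ?dw ?da.
have [p [ap pb up dp]] := IH a b da db ab.
exists (a :: rcons p w); split.
- by rewrite /= adj_sym av rcons_path ap pb.
- by rewrite /= last_rcons.
- have nin x : depth x = n.+1 -> x \notin a :: p.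
    by move=> dx; apply/negP => /dp; rewrite dx ltnn.
  rewrite -rcons_cons cons_uniq rcons_uniq up nin// mem_rcons inE negb_or vw.
  by rewrite nin.
- move=> u; rewrite -rcons_cons in_cons mem_rcons in_cons.
  by case/or3P => [/eqP ->|/eqP ->|/dp]; rewrite ?dv ?dw//; exact: leqW.
Qed.

Lemma parent_unique u v w : children v u -> children w u -> v = w.
Proof.
move=> /childP[vu dv] /childP[wu]; rewrite dv => -[vw].
apply/eqP; apply: contraT => neq.
have [p [vp pw up dp]] := same_depth_path erefl (esym vw) neq.
have : (size (u :: v :: p) <= 2)%N.
  apply: (@tree_acyclic T); apply/andP; split.
    by rewrite /= adj_sym vu rcons_path vp pw wu.
  by rewrite cons_uniq up andbT; apply/negP => /dp; rewrite dv ltnn.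
by case: p pw {vp up dp} => // /= vw'; rewrite vw' eqxx in neq.
Qed.

Lemma boundaryP xi : boundary T xi <->
  xi 0%N = Defs.root T /\ forall n, children (xi n) (xi n.+1).
Proof.
by split=> -[xi0 bxi]; split=> // n; have [a] := bxi n; rewrite distC => e; split.
Qed.

Lemma ray_child xi n : boundary T xi -> children (xi n) (xi n.+1).
Proof. by move=> /boundaryP[_ /(_ n)]. Qed.

Lemma depth_ray xi n : boundary T xi -> depth (xi n) = n.
Proof.
move=> bxi; elim: n => [|n IH]; first by case: bxi => -> _; exact: depth_root.
by have /childP[_ ->] := ray_child n bxi; rewrite IH.
Qed.

Lemma ray_unique xi eta m n : boundary T xi -> boundary T eta -> (m <= n)%N ->
  xi n = eta n -> xi m = eta m.
Proof.
move=> bxi beta /subnK <-; elim: (n - m)%N => // k IH; rewrite addSn => e.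
apply: IH; apply: (@parent_unique (xi (k + m).+1)); first exact: ray_child.
by rewrite e; exact: ray_child.
Qed.

Hypothesis hleaf : no_leaves T.

(** Down to v the ray follows the geodesic, below v it follows chosen children. *)
Lemma ray_exists v : exists xi, boundary T xi /\ xi (depth v) = v.
Proof.
have [c cP] := choice hleaf.
move: {2}(depth v) (erefl (depth v)) => n; elim: n v => [|n IH] v dv.
  exists (fun n => iter n c (Defs.root T)); rewrite dv; split;
    last by rewrite (depth_eq0 dv).
  by apply/boundaryP; split=> // n; exact: cP.
have [u du uv] := parent_exists dv.
have [xi [/boundaryP[xi0 bxi] xiu]] := IH u du; rewrite du in xiu.
exists (fun k => if (k <= n)%N then xi k else iter (k - n.+1) c v).
rewrite dv ltnn subnn; split=> //; apply/boundaryP; split=> // k.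
have [kn|nk] := ltnP k n; first by rewrite (ltnW kn); exact: bxi.
case: (ltngtP k n) nk => // [nk|->] _; last by rewrite subnn xiu.
by rewrite subSn//; exact: cP.
Qed.

(** Used for k <= depth v, where ray v k is the ancestor of v of generation k,
    whatever ray is chosen. *)
Definition ray v : nat -> T := projT1 (cid (ray_exists v)).

Lemma boundary_ray v : boundary T (ray v).
Proof. by rewrite /ray; case: cid => xi []. Qed.

Lemma ray_depth v : ray v (depth v) = v.
Proof. by rewrite /ray; case: cid => xi []. Qed.

Lemma ray_rayE xi m n : boundary T xi -> (m <= n)%N -> ray (xi n) m = xi m.
Proof.
move=> bxi mn; apply: (@ray_unique _ _ m n) => //; first exact: boundary_ray.
by rewrite -{2}(depth_ray n bxi) ray_depth.
Qed.

Hypothesis hfin : locally_finite T.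

Definition child_seq v : seq T := fset_set (children v).

Lemma mem_child_seq v u : (u \in child_seq v) = `[< children v u >].
Proof.
rewrite /child_seq in_fset_set ?inE//.
by apply: sub_finite_set (hfin v) => w /childP[].
Qed.

Fixpoint level_seq n : seq T :=
  if n is m.+1 then [seq u | v <- level_seq m, u <- child_seq v] else [:: Defs.root T].

Lemma mem_level_seq n v : (v \in level_seq n) = (depth v == n).
Proof.
elim: n v => [|n IH] v /=.
  by rewrite inE; apply/eqP/eqP => [->|/depth_eq0//]; exact: depth_root.
apply/allpairsPdep/eqP => [[a [b [aP + ->]]]|dv].
  by rewrite mem_child_seq => /asboolP/childP[_ ->]; move: aP; rewrite IH => /eqP ->.
have [a da av] := parent_exists dv; exists a, v; split => //.
  by rewrite IH da.
by rewrite mem_child_seq; apply/asboolP.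
Qed.

Lemma uniq_level_seq n : uniq (level_seq n).
Proof.
elim: n => //= n IH; apply: allpairs_uniq_dep => //.
  by move=> v _; exact: fset_uniq.
move=> [a b] [a' b'] /allpairsPdep[v [u [_ vu]]] [-> ->].
move=> /allpairsPdep[v' [u' [_ vu']]] [-> ->] /= e; rewrite -e in vu' *.
have -> // : v = v'.
by move: vu vu'; rewrite !mem_child_seq => /asboolP + /asboolP; exact: parent_unique.
Qed.

Lemma ray_level_seq xi n : boundary T xi -> xi n \in level_seq n.
Proof. by move=> bxi; rewrite mem_level_seq depth_ray. Qed.

Lemma ray_child_seq v u k : u \in child_seq v -> (k <= depth v)%N -> ray u k = ray v k.
Proof.
rewrite mem_child_seq => /asboolP uv kv; have [_ du] := (childP v u).1 uv.
apply: (@ray_unique _ _ k (depth v)) => //; try exact: boundary_ray.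
rewrite ray_depth; apply: (@parent_unique u) => //.
by have := ray_child (depth v) (boundary_ray u); rewrite -du ray_depth.
Qed.

End TreeStructure.

(** * Inequalities for the entropy sum *)

(** The index k stands for generation k + 1: in the application a k is
    alpha_(k+1), t k is the l2 norm of the tail of alpha from k + 1 on, and
    b k is ln D_(k+1), so that psum n is L_n and rootsum n is s_n.  Divisions by
    t k are harmless where t k = 0, because a k and the entropy vanish there. *)
Section TailSequences.
Variables (R : realType) (a t b : nat -> R).
Hypotheses (t_ge0 : forall k, 0 <= t k).
Hypothesis (t_rec : forall k, a k ^+ 2 + t k.+1 ^+ 2 = t k ^+ 2).
Hypothesis (b_ge : forall k, 1 / 2 <= b k).

Definition psum (n : nat) : R := \sum_(0 <= k < n) b k.
Definition rootsum (n : nat) : R := Num.sqrt (psum n).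

Lemma psumS n : psum n.+1 = psum n + b n.
Proof. by rewrite /psum big_nat_recr. Qed.

Lemma psum_ge0 n : 0 <= psum n.
Proof. by apply: sumr_ge0 => k _; apply: le_trans (b_ge k); lra. Qed.

Lemma psum_ge n : 1 / 2 <= psum n.+1.
Proof. by rewrite psumS; have := psum_ge0 n; have := b_ge n; lra. Qed.

Lemma psum_ge_nat n : 1 / 2 * n%:R <= psum n.
Proof.
elim: n => [|n IH]; first by rewrite mulr0 psum_ge0.
by rewrite psumS -(natr1 n); have := b_ge n; lra.
Qed.

Lemma rootsum_ge0 n : 0 <= rootsum n. Proof. exact: sqrtr_ge0. Qed.

Lemma sqr_rootsum n : rootsum n ^+ 2 = psum n.
Proof. by rewrite sqr_sqrtr// psum_ge0. Qed.

Lemma rootsum_gt0 n : 0 < rootsum n.+1.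
Proof. by rewrite sqrtr_gt0; have := psum_ge n; lra. Qed.

Lemma rootsum_le n : rootsum n <= rootsum n.+1.
Proof. by rewrite ler_sqrt ?psum_ge0// psumS lerDl; apply: le_trans (b_ge n); lra. Qed.

Lemma tail_le k : t k.+1 <= t k.
Proof. by rewrite -ler_sqr ?nnegrE// -(t_rec k) lerDr sqr_ge0. Qed.

Lemma coef_eq0 k : t k = 0 -> a k = 0.
Proof.
move=> tk; have := t_rec k; rewrite tk expr0n /= => /eqP.
by rewrite paddr_eq0 ?sqr_ge0// sqrf_eq0 => /andP[/eqP].
Qed.

Lemma increment_split k : b k = (rootsum k.+1 - rootsum k) * (rootsum k.+1 + rootsum k).
Proof. by rewrite -subr_sqr !sqr_rootsum psumS addrC addKr. Qed.

Lemma rootsum_increment_le k :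
  rootsum k.+1 - rootsum k <= b k / rootsum k.+1.
Proof.
rewrite ler_pdivlMr ?rootsum_gt0// increment_split ler_wpM2l ?subr_ge0 ?rootsum_le//.
by rewrite lerDl rootsum_ge0.
Qed.

Lemma rootsum_increment_ge k :
  b k / rootsum k.+1 <= 2 * (rootsum k.+1 - rootsum k).
Proof.
rewrite ler_pdivrMr ?rootsum_gt0// increment_split.
by have := rootsum_le k; have := rootsum_ge0 k; nra.
Qed.

(** The derivative of the sum of t j * (rootsum j.+1 - rootsum j) with respect to
    a k is a k * slope_sum k.+1; this is the direction along which the tilt
    of the lower bound is taken. *)
Definition slope_sum (n : nat) : R :=
  \sum_(0 <= j < n) (rootsum j.+1 - rootsum j) / t j.

Lemma slope_sumS n :
  slope_sum n.+1 = slope_sum n + (rootsum n.+1 - rootsum n) / t n.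
Proof. by rewrite /slope_sum big_nat_recr. Qed.

Lemma slope_sum_ge0 n : 0 <= slope_sum n.
Proof. by apply: sumr_ge0 => k _; rewrite divr_ge0// subr_ge0 rootsum_le. Qed.

Lemma slope_sum_le : {homo slope_sum : n m / (n <= m)%N >-> n <= m}.
Proof.
apply: homo_leq => // [n|n]; first exact: le_trans.
by rewrite slope_sumS lerDl divr_ge0// subr_ge0 rootsum_le.
Qed.

(** The second term makes the induction work: it gives t n * slope_sum n <=
    rootsum n, and a n ^+ 2 + t n.+1 ^+ 2 = t n ^+ 2 lets the step complete the
    square rootsum n.+1 ^+ 2. *)
Lemma hardy_slope n :
  \sum_(0 <= k < n) (a k * slope_sum k.+1) ^+ 2 + (t n * slope_sum n) ^+ 2 <= psum n.
Proof.
elim: n => [|n IH].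
  by rewrite /psum /slope_sum !big_nil mulr0 expr0n addr0.
rewrite big_nat_recr//= -addrA !exprMn -mulrDl t_rec.
have tn : t n * slope_sum n <= rootsum n.
  rewrite -ler_sqr ?nnegrE ?rootsum_ge0 ?mulr_ge0 ?slope_sum_ge0//.
  rewrite sqr_rootsum; apply: le_trans IH; rewrite lerDr.
  by apply: sumr_ge0 => k _; exact: sqr_ge0.
have [t0|t0] := eqVneq (t n) 0.
  rewrite t0 expr0n mul0r addr0 psumS; apply: le_trans (_ : psum n <= _).
    by apply: le_trans IH; rewrite lerDl sqr_ge0.
  by rewrite lerDl; apply: le_trans (b_ge n); lra.
rewrite -exprMn slope_sumS mulrDr mulrCA divff// mulr1.
have := rootsum_le n; rewrite -sqr_rootsum; have := rootsum_ge0 n.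
move: IH; rewrite -sqr_rootsum.
move: (\sum_(0 <= k < n) _) (t n * slope_sum n) tn => A B; nra.
Qed.

(** For n = J this is Abel summation, with equality; enlarging n only moves mass
    from the remainder into the sum.  The remainder tends to 0 for fixed J, which
    it need not do along n = J. *)
Lemma sum_slope J n : (J <= n)%N ->
  \sum_(0 <= j < J) t j * (rootsum j.+1 - rootsum j) <=
  \sum_(0 <= k < n) a k ^+ 2 * slope_sum k.+1 + t n ^+ 2 * slope_sum J.
Proof.
move=> /subnK <-; elim: (n - J)%N => [|m IH].
  rewrite add0n; elim: J => [|J IH].
    by rewrite !big_nil /slope_sum big_nil mulr0 addr0.
  rewrite !big_nat_recr//= -addrA -mulrDl t_rec slope_sumS [in leRHS]mulrDr addrA
    lerD//.
  have [->|t0] := eqVneq (t J) 0; first by rewrite expr0n !mul0r.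
  by rewrite mulrCA expr2 mulfK// mulrC.
apply: le_trans IH _; rewrite addSn big_nat_recr//= -addrA lerD2l -t_rec mulrDl.
by rewrite lerD2r ler_wpM2l ?sqr_ge0// slope_sum_le// leqW// leq_addl.
Qed.

Definition ratio (k : nat) : R := t k / rootsum k.+1.
Definition entropy (k : nat) : R := t k * (b k / rootsum k.+1).

Lemma ratio_ge0 k : 0 <= ratio k.
Proof. by rewrite divr_ge0// rootsum_ge0. Qed.

Lemma ratio_le k : ratio k.+1 <= ratio k.
Proof.
rewrite ler_pM ?invr_ge0 ?rootsum_ge0 ?tail_le// lef_pV2 ?posrE ?rootsum_gt0//.
exact: rootsum_le.
Qed.

Lemma entropy_ge0 k : 0 <= entropy k.
Proof.
rewrite mulr_ge0// divr_ge0 ?rootsum_ge0//.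
by apply: le_trans (b_ge k); lra.
Qed.

Lemma entropyE k : entropy k = ratio k * b k.
Proof. by rewrite /entropy /ratio mulrCA mulrC. Qed.

(** Also when ratio k = 0, since then a k = 0. *)
Lemma ratio_sqr k : (ratio k * (a k / ratio k)) = a k.
Proof.
have [r0|r0] := eqVneq (ratio k) 0; last by rewrite mulrC divfK.
have /coef_eq0 -> : t k = 0; last by rewrite mul0r mulr0.
move/eqP: r0; rewrite mulf_eq0 invr_eq0 => /orP[/eqP //|].
by rewrite gt_eqF ?rootsum_gt0.
Qed.

Lemma ratio_quad k :
  ratio k * (a k / ratio k) ^+ 2 <= 2 * (rootsum k.+1 * (t k - t k.+1)).
Proof.
rewrite expr2 mulrA ratio_sqr mulrA -expr2 /ratio invf_div mulrCA -mulrA.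
rewrite [leRHS]mulrCA ler_wpM2l ?rootsum_ge0//.
have [t0|t0] := eqVneq (t k) 0.
  by rewrite t0 invr0 !mulr0 mulr_ge0// -{2}t0 subr_ge0 tail_le.
have tk : 0 < t k by rewrite lt_def t0 t_ge0.
rewrite mulrA -expr2 ler_pdivrMr// -[a k ^+ 2](addrK (t k.+1 ^+ 2)) t_rec.
by have := tail_le k; have := t_ge0 k.+1; nra.
Qed.

Lemma sum_rootsum_dec N n : (N <= n)%N ->
  \sum_(N <= k < n.+1) rootsum k.+1 * (t k - t k.+1) + rootsum n.+1 * t n.+1 <=
  rootsum N.+1 * t N + \sum_(N <= k < n.+1) entropy k.
Proof.
move=> /subnK <-; elim: (n - N)%N => [|m IH].
  rewrite add0n !big_nat1; have := entropy_ge0 N; lra.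
rewrite addSn big_nat_recr ?leqW ?leq_addl//= [in leRHS]big_nat_recr ?leqW ?leq_addl//=.
move: IH; set M := (m + N)%N.
have : (rootsum M.+2 - rootsum M.+1) * t M.+1 <= entropy M.+1.
  by rewrite mulrC ler_wpM2l// rootsum_increment_le.
lra.
Qed.

(** Abel summation: the weighted sum is at least c n times the unweighted one. *)
Lemma abel_ge0 (c u : nat -> R) N n : (forall k, 0 <= c k) ->
  (forall k, c k.+1 <= c k) ->
  (forall m, (N <= m)%N -> 0 <= \sum_(N <= k < m.+1) u k) -> (N <= n)%N ->
  0 <= \sum_(N <= k < n.+1) c k * u k.
Proof.
move=> c0 c_le U Nn; suff H : c n * \sum_(N <= k < n.+1) u k <=
    \sum_(N <= k < n.+1) c k * u k by apply: le_trans H; rewrite mulr_ge0 ?U.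
move: Nn => /subnK <-; elim: (n - N)%N => [|m IH].
  by rewrite add0n !big_nat1.
rewrite addSn big_nat_recr ?leqW ?leq_addl//= [in leRHS]big_nat_recr ?leqW ?leq_addl//=.
rewrite mulrDr lerD2r; apply: le_trans IH.
by rewrite ler_wpM2r ?c_le// U// leq_addl.
Qed.

(** The hypothesis bounds the sums of (a k / ratio k) * z k, and the weights
    ratio k are non-increasing, so the bound may be multiplied by them term by
    term.  The increments 2 * b k of the bound then become 2 * entropy k, and the
    quadratic terms telescope against rootsum. *)
Lemma chaining_bound (N n : nat) (z : nat -> R) (Y r : R) : (N <= n)%N -> 0 <= Y ->
  (forall m, (N <= m)%N ->
    \sum_(N <= k < m.+1) (a k / ratio k) * z k <=
    Y + \sum_(N <= k < m.+1) (a k / ratio k) ^+ 2 / 2 + 2 * psum m.+1) ->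
  rootsum N.+1 * t N + \sum_(N <= k < n.+1) entropy k <= r ->
  \sum_(N <= k < n.+1) a k * z k <= 3 * r * (1 + Y).
Proof.
move=> Nn Y0 H hr.
(* increment of the bound minus increment of the sum; the part of the bound
   that is present from the start is charged to k = N *)
pose u k := (a k / ratio k) ^+ 2 / 2 + 2 * b k + (k == N)%:R * (Y + 2 * psum N)
  - (a k / ratio k) * z k.
have delta (c : nat -> R) m (y : R) : (N <= m)%N ->
    \sum_(N <= k < m.+1) c k * ((k == N)%:R * y) = c N * y.
  move=> Nm; rewrite big_nat_recl// eqxx mul1r big_nat_cond big1 ?addr0//.
  by move=> k; rewrite andbT => /andP[Nk _]; rewrite gtn_eqF// mul0r mulr0.
have : 0 <= \sum_(N <= k < n.+1) ratio k * u k.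
  apply: abel_ge0 => //; [exact: ratio_ge0|exact: ratio_le|move=> m Nm].
  rewrite !big_split/= sumrN -mulr_sumr.
  have -> : \sum_(N <= k < m.+1) (k == N)%:R * (Y + 2 * psum N) = Y + 2 * psum N.
    by rewrite -[RHS]mul1r -(delta (fun=> 1) m)//; apply: eq_bigr => k _; rewrite mul1r.
  have -> : psum N = psum m.+1 - \sum_(N <= k < m.+1) b k.
    by rewrite /psum (@big_cat_nat _ _ _ N 0 m.+1)//= ?addrK ?leqW.
  by have := H m Nm; lra.
have -> : \sum_(N <= k < n.+1) ratio k * u k =
    2^-1 * \sum_(N <= k < n.+1) ratio k * (a k / ratio k) ^+ 2 +
    2 * \sum_(N <= k < n.+1) entropy k + ratio N * (Y + 2 * psum N) -
    \sum_(N <= k < n.+1) a k * z k.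
  rewrite /u; move: (Y + 2 * psum N) => y;
    rewrite -(delta ratio n)// !mulr_sumr -sumrN -!big_split/=.
  apply: eq_bigr => k _; rewrite entropyE -{4}(ratio_sqr k);
    move: (a k / ratio k) => q; lra.
have Q : \sum_(N <= k < n.+1) ratio k * (a k / ratio k) ^+ 2 <= 2 * r.
  apply: le_trans (_ : \sum_(N <= k < n.+1) 2 * (rootsum k.+1 * (t k - t k.+1)) <= _).
    by apply: ler_sum => i _; exact: ratio_quad.
  rewrite -mulr_sumr ler_wpM2l//; apply: le_trans hr.
  apply: le_trans (sum_rootsum_dec Nn); rewrite lerDl mulr_ge0// rootsum_ge0//.
have E0 : 0 <= \sum_(N <= k < n.+1) entropy k.
  by apply: sumr_ge0 => i _; exact: entropy_ge0.
have rN : ratio N * psum N.+1 = rootsum N.+1 * t N.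
  by rewrite -sqr_rootsum /ratio expr2 mulrA divfK ?gt_eqF ?rootsum_gt0// mulrC.
have psum_le : psum N <= psum N.+1.
  by rewrite psumS lerDl; apply: le_trans (b_ge N); lra.
have h1 : ratio N * psum N <= ratio N * psum N.+1 by rewrite ler_wpM2l ?ratio_ge0.
have h2 : ratio N * (1 / 2) <= ratio N * psum N.+1.
  by rewrite ler_wpM2l ?ratio_ge0 ?psum_ge.
rewrite -rN in hr; have r0 := ratio_ge0 N.
have rY : 0 <= r * Y by rewrite mulr_ge0//; lra.
have h3 : ratio N * Y <= 2 * r * Y by rewrite ler_wpM2r//; lra.
lra.
Qed.

(** The difference rootsum N.+1 - rootsum M times t N is at most the tail of the
    series from M on, because t is non-increasing; and rootsum M * t N tends to 0
    for fixed M. *)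
Lemma entropy_tail_small (B e : R) :
  t k ^+ 2 @[k --> \oo] --> 0 ->
  (forall n, \sum_(0 <= k < n) entropy k <= B) -> 0 < e ->
  exists N0, forall N n, (N0 <= N)%N -> (N <= n)%N ->
    rootsum N.+1 * t N + \sum_(N <= k < n.+1) entropy k <= e.
Proof.
move=> t_cvg entB e0; pose S n := \sum_(0 <= k < n) entropy k.
have ent0 := entropy_ge0.
have S_nd : nondecreasing_seq S.
  by apply/nondecreasing_seqP => n; rewrite /S big_nat_recr//= lerDl ent0.
have /cvg_ex[l Sl] : cvgn S.
  by apply: nondecreasing_is_cvgn => //; exists B => _ [n _ <-]; exact: entB.
have e3 : 0 < e / 3 by rewrite divr_gt0.
have [M _ SM] := (@cvgrPdist_lt _ _ _ _ _ _ _).1 Sl _ e3.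
have Sle n : S n <= l.
  by rewrite -(cvg_lim _ Sl)//; apply: nondecreasing_cvgn_le => //; apply/cvg_ex;
    exists l.
have tailM N n : (M <= N)%N -> (N <= n)%N -> \sum_(N <= k < n) entropy k <= e / 3.
  move=> MN Nn; have := SM N MN; rewrite ger0_norm ?subr_ge0// => lt_N.
  have : S n = S N + \sum_(N <= k < n) entropy k by rewrite /S -big_cat_nat.
  by have := Sle n; lra.
pose c := (e / 3) ^+ 2 / (rootsum M ^+ 2 + 1).
have c0 : 0 < c by rewrite divr_gt0 ?exprn_gt0//; have := sqr_ge0 (rootsum M); lra.
have [M' _ tM'] := (@cvgrPdist_lt _ _ _ _ _ _ _).1 t_cvg _ c0.
exists (maxn M M') => N n; rewrite geq_max => /andP[MN M'N] Nn.
have rt : rootsum M * t N <= e / 3.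
  rewrite -ler_sqr ?nnegrE ?mulr_ge0 ?rootsum_ge0//; last exact: ltW.
  have := tM' N M'N; rewrite sub0r normrN ger0_norm ?sqr_ge0// /c.
  rewrite ltr_pdivlMr; last by have := sqr_ge0 (rootsum M); lra.
  by have := sqr_ge0 (t N); rewrite exprMn; nra.
have inc : t N * (rootsum N.+1 - rootsum M) <= e / 3.
  apply: le_trans (tailM M N.+1 _ _) => //; last exact: leqW.
  rewrite -(@telescope_sumr _ M N.+1 (rootsum)) ?leqW// mulr_sumr.
  rewrite big_nat [leRHS]big_nat; apply: ler_sum => k /andP[_ kN].
  apply: ler_pM => //; first by rewrite subr_ge0 rootsum_le.
    have := kN; rewrite ltnS => /subnK <-; elim: (N - k)%N => // m IH.
    by rewrite addSn; apply: le_trans IH; exact: tail_le.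
  exact: rootsum_increment_le.
by have := tailM N n.+1 MN (leqW Nn); lra.
Qed.

End TailSequences.

(** * Tail norms, degrees and the uniform flow *)

Section TailNorm.
Variables (R : realType) (alpha : nat -> R).
Hypothesis (halpha2 : (\sum_(1 <= k <oo) (alpha k ^+ 2)%:E < +oo)%E).

Let total : R := limn (fun n => \sum_(1 <= k < n) alpha k ^+ 2).

Let cvg_total : (\sum_(1 <= k < n) alpha k ^+ 2) @[n --> \oo] --> total.
Proof.
apply: nondecreasing_is_cvgn.
  apply/nondecreasing_seqP => -[|n]; first by rewrite !big_geq.
  by rewrite [leRHS]big_nat_recr//= lerDl sqr_ge0.
have fin : (\sum_(1 <= k <oo) (alpha k ^+ 2)%:E)%E \is a fin_num.
  by rewrite ge0_fin_numE// nneseries_ge0// => k _ _; rewrite lee_fin sqr_ge0.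
exists (fine (\sum_(1 <= k <oo) (alpha k ^+ 2)%:E)%E) => _ [n _ <-].
rewrite -lee_fin fineK// -sumEFin; apply: nneseries_lim_ge => k _ _.
by rewrite lee_fin sqr_ge0.
Qed.

Lemma tail_norm_ge0 l : 0 <= tail_norm alpha l.
Proof. exact: sqrtr_ge0. Qed.

Lemma sqr_tail_norm l :
  tail_norm alpha l ^+ 2 = total - \sum_(1 <= k < l.+1) alpha k ^+ 2.
Proof.
have tailE : (\sum_(l.+1 <= k < n) alpha k ^+ 2) @[n --> \oo] -->
    total - \sum_(1 <= k < l.+1) alpha k ^+ 2.
  apply: cvg_trans (cvgB cvg_total (cvg_cst _)); apply: near_eq_cvg.
  near=> n; rewrite !fctE (@big_cat_nat _ _ _ l.+1 1 n)//=; last by near: n;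
    exact: nbhs_infty_ge.
  by rewrite addrC addrA addNr add0r.
rewrite /tail_norm (cvg_lim _ tailE)// sqr_sqrtr//.
rewrite -(cvg_lim _ tailE)//; apply: limr_ge; first by apply/cvg_ex; eexists;
  exact: tailE.
by apply: nearW => n; apply: sumr_ge0 => k _; exact: sqr_ge0.
Unshelve. all: by end_near. Qed.

Lemma tail_norm_rec l :
  alpha l.+1 ^+ 2 + tail_norm alpha l.+1 ^+ 2 = tail_norm alpha l ^+ 2.
Proof. by rewrite !sqr_tail_norm [in LHS]big_nat_recr//=; lra. Qed.

Lemma cvg_tail_norm : tail_norm alpha l ^+ 2 @[l --> \oo] --> 0.
Proof.
have S : (\sum_(1 <= k < n.+1) alpha k ^+ 2) @[n --> \oo] --> total.
  by move: cvg_total; rewrite -cvg_shiftS.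
have H : (total - \sum_(1 <= k < n.+1) alpha k ^+ 2) @[n --> \oo] --> total - total.
  by apply: cvgB => //; exact: cvg_cst.
rewrite subrr in H; apply: cvg_trans H; apply: near_eq_cvg; apply: nearW => l.
by rewrite sqr_tail_norm.
Qed.

Lemma sum_sqr_le n : \sum_(1 <= k < n.+1) alpha k ^+ 2 <= tail_norm alpha 0 ^+ 2.
Proof.
rewrite sqr_tail_norm [in leRHS]big_geq// subr0.
have := sqr_ge0 (tail_norm alpha n); rewrite sqr_tail_norm; lra.
Qed.

End TailNorm.

Section Degrees.
Variables (R : realType) (T : rooted_tree).
Hypotheses (hfin : locally_finite T) (hleaf : no_leaves T).
Hypothesis (hDmin : 2 <= Dmin R T).

Lemma nchildren_ge2 (v : T) : (2 : R) <= (nchildren v)%:R.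
Proof.
apply: le_trans hDmin _; apply: ge_inf; last by exists v.
by exists 0 => _ [w _ <-].
Qed.

Lemma level_nonempty n : exists v : T, depth v = n.
Proof.
exists (ray hleaf (Defs.root T) n); apply: depth_ray; exact: boundary_ray.
Qed.

Lemma le_Dmax_at (v : T) : (nchildren v)%:R <= Dmax_at R T (depth v).+1.
Proof.
apply: ub_le_sup; last by exists v.
exists (\sum_(w <- level_seq T (depth v)) (nchildren w)%:R) => _ [w /= dw <-].
have ws : w \in level_seq T (depth v) by rewrite mem_level_seq// dw.
by rewrite (big_rem w)//= lerDl sumr_ge0.
Qed.

Lemma ge_Dmin_at (v : T) : Dmin_at R T (depth v).+1 <= (nchildren v)%:R.
Proof. by apply: ge_inf; [exists 0 => _ [w _ <-]|exists v]. Qed.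

Lemma Dmin_at_ge2 n : 2 <= Dmin_at R T n.+1.
Proof.
apply: lb_le_inf; last by move=> _ [w _ <-]; exact: nchildren_ge2.
by have [v dv] := level_nonempty n; exists (nchildren v)%:R; exists v.
Qed.

Lemma Dmax_at_ge2 n : 2 <= Dmax_at R T n.+1.
Proof.
have [v dv] := level_nonempty n; rewrite -dv.
exact: le_trans (nchildren_ge2 v) (le_Dmax_at v).
Qed.

Definition log_degree (k : nat) : R := ln (Dmax_at R T k.+1).

Lemma log_degree_ge k : 1 / 2 <= log_degree k.
Proof.
apply: le_trans (ln2_ge R) _; rewrite ler_ln ?posrE ?Dmax_at_ge2//.
by apply: lt_le_trans (Dmax_at_ge2 k).
Qed.

Lemma entropy_termE (alpha : nat -> R) l :
  entropy_term T alpha l = entropy (tail_norm alpha) log_degree l.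
Proof.
rewrite /entropy_term /entropy /rootsum /psum; congr (_ * (_ / Num.sqrt _)).
rewrite big_add1 /=; elim: l.+1 => [|n IH]; first by rewrite !big_nil ln1.
rewrite !big_nat_recr//= lnM ?IH// posrE.
  by apply: prodr_gt0 => i _; apply: lt_le_trans (Dmax_at_ge2 i).
by apply: lt_le_trans (Dmax_at_ge2 n).
Qed.

Lemma size_level_seq n :
  (size (level_seq T n))%:R <= expR (psum log_degree n).
Proof.
elim: n => [|n IH]; first by rewrite /psum big_nil expR0.
rewrite psumS expRD lnK ?posrE; last by apply: lt_le_trans (Dmax_at_ge2 n).
rewrite /= size_allpairs_dep sumnE big_map natr_sum.
apply: le_trans (_ : \sum_(v <- level_seq T n) Dmax_at R T n.+1 <= _).
  rewrite big_seq [leRHS]big_seq; apply: ler_sum => v.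
  by rewrite mem_level_seq// => /eqP <-; exact: le_Dmax_at.
rewrite big_const_seq count_predT iter_addr_0 -mulr_natl ler_wpM2r//.
by apply: le_trans (Dmax_at_ge2 n).
Qed.

(** The unit flow from the root that divides equally among the children. *)
Definition flow (v : T) : R :=
  \prod_(0 <= k < depth v) ((nchildren (ray hleaf v k))%:R)^-1.

Lemma flow_ge0 v : 0 <= flow v.
Proof. by apply: prodr_ge0 => k _; rewrite invr_ge0. Qed.

Lemma flow_child u v : u \in child_seq v -> flow u = flow v / (nchildren v)%:R.
Proof.
move=> uv; have := uv; rewrite mem_child_seq// => /asboolP/childP[_ du].
rewrite /flow du big_nat_recr//= (ray_child_seq hleaf hfin uv)// ray_depth.
congr (_ / _); apply: eq_big_nat => k /andP[_ kv].
by rewrite (ray_child_seq hleaf hfin uv)// ltnW.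
Qed.

Lemma sum_flow_below n (v : T) : (depth v <= n)%N ->
  \sum_(w <- level_seq T n) flow w * (ray hleaf w (depth v) == v)%:R = flow v.
Proof.
move=> /subnK <-; elim: (n - depth v)%N => [|m IH].
  rewrite add0n (bigD1_seq v) ?uniq_level_seq ?mem_level_seq//=.
  rewrite ray_depth eqxx mulr1 big_seq_cond big1 ?addr0// => w.
  rewrite mem_level_seq// => /andP[/eqP <- /negbTE wv].
  by rewrite ray_depth wv mulr0.
rewrite addSn /= big_allpairs_dep/= -[RHS]IH; apply: eq_big_seq => w.
rewrite mem_level_seq// => /eqP dw.
transitivity (\sum_(u <- child_seq w)
    flow w / (nchildren w)%:R * (ray hleaf w (depth v) == v)%:R).
  apply: eq_big_seq => u uw; rewrite (flow_child uw).
  by rewrite (ray_child_seq hleaf hfin uw)// dw leq_addl.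
rewrite big_const_seq count_predT iter_addr_0 -[LHS]mulr_natr mulrAC divfK//.
by rewrite gt_eqF//; apply: lt_le_trans (nchildren_ge2 w).
Qed.

Lemma sum_flow n : \sum_(w <- level_seq T n) flow w = 1.
Proof.
transitivity (flow (Defs.root T)); last by rewrite /flow depth_root big_geq.
rewrite -(@sum_flow_below n) ?depth_root//; apply: eq_bigr => w _.
by have [-> _] := boundary_ray hleaf w; rewrite eqxx mulr1.
Qed.

(** The bound on the ratio of logarithms enters here: it converts the minimal
    degrees, which control the flow, into the maximal ones, which make up psum. *)
Lemma flow_le (K : R) v : 0 < K ->
  (forall k, log_degree k <= K * ln (Dmin_at R T k.+1)) ->
  flow v <= expR (- (psum log_degree (depth v) / K)).
Proof.
move=> K0 hK; rewrite /psum mulr_suml -sumrN expR_sum.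
rewrite /flow big_nat [leRHS]big_nat; apply: ler_prod => k /andP[_ kv];
  rewrite invr_ge0 ler0n/= expRN.
have d0 : 0 < Dmin_at R T k.+1 := lt_le_trans (ltr0Sn _ _) (Dmin_at_ge2 k).
have dk : depth (ray hleaf v k) = k by apply: depth_ray; exact: boundary_ray.
rewrite lef_pV2 ?posrE ?expR_gt0//; last first.
  by apply: lt_le_trans (nchildren_ge2 _).
apply: le_trans (_ : Dmin_at R T k.+1 <= _); last first.
  by have := ge_Dmin_at (ray hleaf v k); rewrite dk.
by rewrite -[leRHS]lnK ?posrE// ler_expR ler_pdivrMr// mulrC.
Qed.

End Degrees.

(** * Gaussian sums along rays *)

Section GaussianTree.
Variables (R : realType) (T : rooted_tree).
Hypotheses (hfin : locally_finite T) (hleaf : no_leaves T).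
Hypothesis (hDmin : 2 <= Dmin R T).
Variable (alpha : nat -> R).
Hypothesis (halpha2 : (\sum_(1 <= k <oo) (alpha k ^+ 2)%:E < +oo)%E).
Variables (d : measure_display) (Omega : measurableType d).
Variables (P : probability Omega R) (Z : T -> {RV P >-> R}).
Hypothesis (hZindep : mutually_independent Z).
Hypothesis (hZgauss : forall v : T, standard_gaussian (Z v)).

Local Notation t := (tail_norm alpha).
Local Notation b := (log_degree R T).

Lemma measurable_lincomb (r : seq nat) (c : nat -> R) (v : nat -> T) :
  measurable_fun setT (fun w => \sum_(k <- r) c k * Z (v k) w).
Proof. by apply: measurable_sum => k; exact: measurable_funM. Qed.

Lemma measurable_expR_lincomb (r : seq nat) (c : nat -> R) (v : nat -> T) :
  measurable_fun setT (fun w => expR (\sum_(k <- r) c k * Z (v k) w)).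
Proof. by apply: measurableT_comp => //; exact: measurable_lincomb. Qed.

Lemma ray_eqE xi k l : boundary T xi -> (xi k == xi l) = (k == l).
Proof.
move=> bxi; apply/eqP/eqP => [e|-> //].
by rewrite -(depth_ray k bxi) e depth_ray.
Qed.

Lemma integral_expR_ray (c : nat -> R) xi m n : boundary T xi ->
  (\int[P]_w (expR (\sum_(m <= k < n) c k * Z (xi k.+1) w))%:E =
   (expR (\sum_(m <= k < n) c k ^+ 2 / 2))%:E)%E.
Proof.
move=> bxi; rewrite (integral_expR_gauss hZindep hZgauss); congr (expR _)%:E.
rewrite -mulr_suml; congr (_ / _); apply: eq_big_seq => k kr.
rewrite -[RHS](sum_delta (fun l => c k * c l) (iota_uniq _ _) kr).
by apply: eq_bigr => l _; rewrite ray_eqE.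
Qed.

Lemma ray_sumE m n xi w :
  ray_sum alpha Z m.+1 n.+1 xi w = \sum_(m <= k < n) alpha k.+1 * Z (xi k.+1) w.
Proof. by rewrite /ray_sum big_add1. Qed.

Lemma tail_sup_ge n m xi N w : (N <= n)%N -> boundary T xi ->
  ((`|ray_sum alpha Z n (n + m).+1 xi w| ^+ 2)%:E <= tail_sup alpha Z N w)%E.
Proof.
move=> Nn bxi.
apply: le_ereal_sup_tmp; eexists; first by exists n.
apply: le_ereal_sup_tmp; eexists; first by exists m.
by apply: le_ereal_sup_tmp; eexists; first by exists xi.
Qed.

Lemma tail_sup_ge0 N w : (0 <= tail_sup alpha Z N w)%E.
Proof.
apply: le_trans (tail_sup_ge 0 w (leqnn N) (boundary_ray hleaf (Defs.root T))).
by rewrite lee_fin sqr_ge0.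
Qed.

(** * From the entropy condition to the tails *)

(** This is lambda_k alpha_k, where lambda_k is the inverse of the
    non-increasing sequence ratio. *)
Let scaled_coef k := alpha k.+1 / ratio t b k.

(** The sign e is 1 or -1. The term 2 * psum, rather than psum, compensates for
    the number of vertices with room to spare, so that the sum over all
    generations has finite mean. *)
Let tilt_weight (N n : nat) (e : R) (v : T) (w : Omega) : R :=
  expR (- (\sum_(N <= k < n.+1) scaled_coef k ^+ 2 / 2 + 2 * psum b n.+1)) *
  expR (\sum_(N <= k < n.+1) (e * scaled_coef k) * Z (ray hleaf v k.+1) w).

Let level_weight (N n : nat) (w : Omega) : R :=
  \sum_(v <- level_seq T (N + n).+1)
    (tilt_weight N (N + n) 1 v w + tilt_weight N (N + n) (-1) v w).

Let measurable_tilt_weight N n e v : measurable_fun setT (tilt_weight N n e v).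
Proof. by apply: measurable_funM => //; exact: measurable_expR_lincomb. Qed.

Let tilt_weight_ge0 N n e v w : 0 <= tilt_weight N n e v w.
Proof. by rewrite mulr_ge0 ?expR_ge0. Qed.

Let integral_tilt_weight N n e v : e ^+ 2 = 1 ->
  (\int[P]_w (tilt_weight N n e v w)%:E = (expR (- (2 * psum b n.+1)))%:E)%E.
Proof.
move=> e1; under eq_integral do rewrite /tilt_weight EFinM.
rewrite ge0_integralZl_EFin ?expR_ge0//; last first.
  by apply/measurable_EFinP; exact: measurable_expR_lincomb.
rewrite integral_expR_ray; last exact: boundary_ray.
rewrite -EFinM -expRD; congr (expR _)%:E.
under [X in _ + X]eq_bigr do rewrite exprMn e1 mul1r.
by rewrite opprD addrAC addNr add0r.
Qed.

Let measurable_level_weight N n : measurable_fun setT (level_weight N n).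
Proof.
by apply: measurable_sum => v; apply: measurable_funD; exact: measurable_tilt_weight.
Qed.

Let level_weight_ge0 N n w : 0 <= level_weight N n w.
Proof. by apply: sumr_ge0 => v _; rewrite addr_ge0. Qed.

Let weight_bound : R := 2 * (1 - expR (- (1 / 2)))^-1.

Let integral_level_weight N n : (\int[P]_w (level_weight N n w)%:E <= (2 * expR (- (1 /
  2 * n%:R)))%:E)%E.
Proof.
under eq_integral do rewrite /level_weight -sumEFin.
rewrite ge0_integral_sum//; last 2 first.
- by move=> v; apply/measurable_EFinP; apply: measurable_funD;
    exact: measurable_tilt_weight.
- by move=> v w _; rewrite lee_fin addr_ge0.
under eq_bigr => v _.
  under eq_integral do rewrite EFinD.
  rewrite ge0_integralD//; [|by move=> w _; rewrite lee_fin|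
    by apply/measurable_EFinP; exact: measurable_tilt_weight|by move=> w _;
      rewrite lee_fin|
    by apply/measurable_EFinP; exact: measurable_tilt_weight].
  rewrite !integral_tilt_weight ?sqrrN ?expr1n// -EFinD; over.
rewrite sumEFin lee_fin big_const_seq count_predT iter_addr_0.
set x := expR _; rewrite -[leLHS]mulr_natl.
have -> : x = expR (- psum b (N + n).+1) * expR (- psum b (N + n).+1).
  by rewrite /x -expRD; congr expR; ring.
have /(_ (N + n).+1) hs := size_level_seq hfin hleaf hDmin.
set p := psum b _ in hs *.
have : (size (level_seq T (N + n).+1))%:R * expR (- p) <= 1.
  by rewrite -[leRHS](expRxMexpNx_1 p) ler_wpM2r ?expR_ge0.
have : expR (- p) <= expR (- (1 / 2 * n%:R)).
  rewrite ler_expR lerN2;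
    apply: le_trans (psum_ge_nat (log_degree_ge hfin hleaf hDmin) _).
  by rewrite ler_wpM2l// ler_nat leqW ?leq_addl.
have := expR_ge0 (- p).
move: (size _)%:R (expR _) (expR _) => X A B; nra.
Qed.

Let total_weight N w : \bar R := (\sum_(0 <= n <oo) (level_weight N n w)%:E)%E.

Let integral_total_weight N : (\int[P]_w total_weight N w <= weight_bound%:E)%E.
Proof.
rewrite /total_weight integral_nneseries//; last 2 first.
- by move=> n; apply/measurable_EFinP; exact: measurable_level_weight.
- by move=> n w _; rewrite lee_fin.
apply: lime_le; first by apply: is_cvg_nneseries => n _ _; apply: integral_ge0 => w _;
  rewrite lee_fin.
apply: nearW => n;
  apply: le_trans (_ : (\sum_(0 <= k < n) (2 * expR (- (1 / 2 * k%:R)))%:E)%E <= _)%E.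
  by apply: lee_sum => k _; exact: integral_level_weight.
rewrite sumEFin lee_fin -mulr_sumr ler_wpM2l// sum_expR_le//; lra.
Qed.

(** Each weight is at most their sum g; taking logarithms gives the hypothesis of
    [chaining_bound] for both signs. *)
Lemma chaining_ray (N n : nat) xi w (g r : R) : (N <= n)%N -> boundary T xi ->
  total_weight N w = g%:E ->
  rootsum b N.+1 * t N + \sum_(N <= k < n.+1) entropy t b k <= r ->
  `|ray_sum alpha Z N.+1 n.+2 xi w| <= 3 * r * (1 + ln (1 + g)).
Proof.
move=> Nn bxi Gg hr.
have hb := log_degree_ge hfin hleaf hDmin.
have G_ge m : level_weight N m w <= g.
  rewrite -lee_fin -Gg; apply: le_trans (nneseries_lim_ge m.+1 _) => [|? _ _];
    last by rewrite lee_fin.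
  by rewrite sumEFin lee_fin big_nat_recr//= lerDr sumr_ge0.
have g0 : 0 <= g by apply: le_trans (G_ge 0%N).
have Y0 : 0 <= ln (1 + g) by rewrite ln_ge0// lerDl.
have bound e m : e ^+ 2 = 1 -> (N <= m)%N ->
    \sum_(N <= k < m.+1) scaled_coef k * (e * Z (xi k.+1) w) <=
    ln (1 + g) + \sum_(N <= k < m.+1) scaled_coef k ^+ 2 / 2 + 2 * psum b m.+1.
  move=> e1 Nm; rewrite -addrA -lerBlDr -ler_expR lnK ?posrE; last by lra.
  apply: le_trans (_ : g <= _); last by rewrite lerDr.
  apply: le_trans (G_ge (m - N)%N); rewrite /level_weight subnKC//.
  have xim : xi m.+1 \in level_seq T m.+1 by exact: ray_level_seq.
  have -> : expR (\sum_(N <= k < m.+1) scaled_coef k * (e * Z (xi k.+1) w) -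
      (\sum_(N <= k < m.+1) scaled_coef k ^+ 2 / 2 + 2 * psum b m.+1)) = tilt_weight N
        m e (xi m.+1) w.
    rewrite /tilt_weight -expRD addrC; congr (expR (_ + _)).
    apply: eq_big_nat => k /andP[_ km]; rewrite (ray_rayE _ bxi)//.
    by rewrite mulrCA mulrA.
  rewrite (bigD1_seq _ xim) ?uniq_level_seq//=.
  rewrite -[leLHS]addr0 lerD//; last by apply: sumr_ge0 => v _; rewrite addr_ge0.
  move/eqP: e1; rewrite sqrf_eq1 => /orP[]/eqP ->; [rewrite lerDl|rewrite lerDr];
    exact: tilt_weight_ge0.
have main e : e ^+ 2 = 1 ->
    \sum_(N <= k < n.+1) alpha k.+1 * (e * Z (xi k.+1) w) <= 3 * r * (1 + ln (1 + g)).
  move=> e1; apply: (chaining_bound (tail_norm_ge0 alpha) (tail_norm_rec halpha2) hb Nn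
    Y0 _ hr).
  by move=> m; exact: bound.
rewrite ray_sumE ler_norml; apply/andP; split.
  rewrite lerNl; have := main (-1); rewrite sqrrN expr1n => /(_ erefl).
  by under eq_bigr do rewrite mulN1r mulrN; rewrite sumrN.
have := main 1; rewrite expr1n => /(_ erefl).
by under eq_bigr do rewrite mul1r.
Qed.

(** A block of a ray is the difference of two blocks that start at N.+1, each at
    most 3 * r * (1 + ln (1 + total_weight)); hence the factor 6^2 * 4 = 144. *)
Lemma integral_tail_sup (N : nat) (r : R) : 0 < r ->
  (forall n, (N <= n)%N ->
    rootsum b N.+1 * t N + \sum_(N <= k < n.+1) entropy t b k <= r) ->
  (\int[P]_w tail_sup alpha Z N.+1 w <= (144 * r ^+ 2 * (1 + weight_bound))%:E)%E.
Proof.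
move=> r0 hr.
have mG : measurable_fun setT (total_weight N).
  by apply: ge0_emeasurable_sum => [n w _ _|n _];
    [rewrite lee_fin|apply/measurable_EFinP; exact: measurable_level_weight].
have G0 w : (0 <= total_weight N w)%E by apply: nneseries_ge0 => n _ _; rewrite lee_fin.
apply: le_trans (_ : \int[P]_w ((144 * r ^+ 2)%:E * (1 + total_weight N w)) <= _)%E.
  apply: ge0_le_integralT => w; first exact: tail_sup_ge0.
  case Gw : (total_weight N w) (G0 w) => [g| |//] g0; last first.
    by rewrite addey// gt0_muley ?leey// lte_fin mulr_gt0// exprn_gt0.
  rewrite lee_fin in g0.
  apply: ge_ereal_sup => _ [n /= Nn <-]; apply: ge_ereal_sup => _ [m _ <-].
  apply: ge_ereal_sup => _ [xi bxi <-].
  rewrite -EFinD -EFinM lee_fin.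
  have Y0 : 0 <= ln (1 + g) by rewrite ln_ge0// lerDl.
  have rY : 0 <= 3 * r * (1 + ln (1 + g)) by rewrite mulr_ge0 ?mulr_ge0 ?addr_ge0// ltW.
  have short k : (N < k)%N ->
      `|ray_sum alpha Z N.+1 k xi w| <= 3 * r * (1 + ln (1 + g)).
    rewrite leq_eqVlt => /orP[/eqP <-|].
      by rewrite /ray_sum big_geq// normr0.
    case: k => [//|[//|k]]; rewrite !ltnS => Nk.
    by apply: chaining_ray => //; exact: hr.
  have -> : ray_sum alpha Z n (n + m).+1 xi w =
      ray_sum alpha Z N.+1 (n + m).+1 xi w - ray_sum alpha Z N.+1 n xi w.
    have nm : (n <= (n + m).+1)%N := leqW (leq_addr m n).
    by rewrite /ray_sum (big_cat_nat Nn nm)/= [X in _ = X - _]addrC addrK.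
  have h : `|ray_sum alpha Z N.+1 (n + m).+1 xi w - ray_sum alpha Z N.+1 n xi w|
      <= 6 * r * (1 + ln (1 + g)).
    apply: le_trans (ler_normB _ _) _.
    by have := short n Nn;
      have := short (n + m).+1 (leq_trans Nn (leqW (leq_addr _ _))); lra.
  apply: le_trans (_ : (6 * r * (1 + ln (1 + g))) ^+ 2 <= _).
    by rewrite ler_sqr ?nnegrE//; lra.
  have := ler_wpM2l (sqr_ge0 r) (sqr_ln_le g0).
  by rewrite !exprMn; move: (r ^+ 2) ((1 + ln (1 + g)) ^+ 2) => A B; lra.
rewrite ge0_integralZl_EFin//; last 3 first.
- by move=> w _; rewrite adde_ge0.
- by apply: emeasurable_funD => //.
- by rewrite mulr_ge0// sqr_ge0.
rewrite ge0_integralD// integral_cst//.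
have -> : (1 * P [set: Omega] = 1)%E by rewrite mul1e; exact: probability_setT.
rewrite [leRHS]EFinM lee_wpmul2l//.
  by rewrite lee_fin mulr_ge0// sqr_ge0.
by rewrite EFinD leeD2l// integral_total_weight.
Qed.

Lemma tail_of_entropy :
  (\sum_(0 <= l <oo) (entropy_term T alpha l)%:E < +oo)%E ->
  (\int[P]_w tail_sup alpha Z N w)%E @[N --> \oo] --> 0%E.
Proof.
move=> ent; have hb := log_degree_ge hfin hleaf hDmin.
have entE l := entropy_termE hfin hleaf hDmin alpha l.
have ent0 l : 0 <= entropy t b l := entropy_ge0 (tail_norm_ge0 alpha) hb l.
pose B := fine (\sum_(0 <= l <oo) (entropy_term T alpha l)%:E)%E.
have entB n : \sum_(0 <= k < n) entropy t b k <= B.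
  rewrite -lee_fin /B fineK; last first.
    by rewrite ge0_fin_numE// nneseries_ge0// => k _ _; rewrite lee_fin entE.
  rewrite -sumEFin; under eq_bigr do rewrite -entE.
  by apply: nneseries_lim_ge => k _ _; rewrite lee_fin entE.
have weight_bound_ge0 : 0 <= weight_bound.
  by rewrite mulr_ge0// invr_ge0 subr_ge0 expR_le1; lra.
apply/cvge0P => [N|e e0]; first by apply: integral_ge0 => w _; exact: tail_sup_ge0.
pose c : R := 144 * (1 + weight_bound).
have c0 : 0 < c by rewrite /c; lra.
pose r := Num.min 1 (e / c).
have r0 : 0 < r by rewrite lt_min ltr01 divr_gt0.
have r1 : r <= 1 by rewrite ge_min lexx.
have rc : r * c <= e by rewrite -ler_pdivlMr// ge_min lexx orbT.
have [N0 hN0] := entropy_tail_small (tail_norm_ge0 alpha) (tail_norm_rec halpha2)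
  hb (cvg_tail_norm halpha2) entB r0.
exists N0.+1 => -[//|N] NN; apply: le_trans (integral_tail_sup r0 _) _.
  by move=> n Nn; exact: hN0.
rewrite lee_fin; apply: le_trans rc; rewrite mulrAC mulrC ler_wpM2r ?(ltW c0)//.
by rewrite expr2 ler_piMr// ltW.
Qed.

(** * From boundedness to the entropy condition *)

Definition has_mean (f : Omega -> R) (m : R) : Prop :=
  [/\ measurable_fun setT f, forall w, 0 <= f w
    & (\int[P]_w (f w)%:E = m%:E)%E].

Lemma has_mean_le f g m p : has_mean f m -> has_mean g p ->
  (forall w, f w <= g w) -> m <= p.
Proof.
move=> [mf f0 fm] [mg g0 gp] fg; rewrite -lee_fin -fm -gp.
by apply: ge0_le_integralT => w; rewrite lee_fin.
Qed.

Lemma has_meanD f g m p : has_mean f m -> has_mean g p ->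
  has_mean (fun w => f w + g w) (m + p).
Proof.
move=> [mf f0 fm] [mg g0 gp]; split; first exact: measurable_funD.
  by move=> w; rewrite addr_ge0.
under eq_integral do rewrite EFinD.
rewrite ge0_integralD// ?fm ?gp//.
- by move=> w _; rewrite lee_fin.
- exact/measurable_EFinP.
- by move=> w _; rewrite lee_fin.
- exact/measurable_EFinP.
Qed.

Lemma has_meanZ c f m : 0 <= c -> has_mean f m ->
  has_mean (fun w => c * f w) (c * m).
Proof.
move=> c0 [mf f0 fm]; split; first exact: measurable_funM.
  by move=> w; rewrite mulr_ge0.
under eq_integral do rewrite EFinM.
rewrite ge0_integralZl_EFin ?fm//.
  by move=> w _; rewrite lee_fin.
exact/measurable_EFinP.
Qed.

Lemma has_mean_sum (I : Type) (r : seq I) (f : I -> Omega -> R) (m : I -> R) :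
  (forall i, has_mean (f i) (m i)) ->
  has_mean (fun w => \sum_(i <- r) f i w) (\sum_(i <- r) m i).
Proof.
move=> H; split.
- by apply: measurable_sum => i; have [] := H i.
- by move=> w; apply: sumr_ge0 => i _; have [] := H i.
under eq_integral do rewrite -sumEFin.
rewrite ge0_integral_sum//.
- by rewrite -sumEFin; apply: eq_bigr => i _; have [] := H i.
- by move=> i; apply/measurable_EFinP; have [] := H i.
- by move=> i w _; rewrite lee_fin; have [] := H i.
Qed.

Lemma has_mean_expR_ray (c : nat -> R) xi n : boundary T xi ->
  has_mean (fun w => expR (\sum_(0 <= k < n) c k * Z (xi k.+1) w))
    (expR (\sum_(0 <= k < n) c k ^+ 2 / 2)).
Proof.
move=> bxi; split; first exact: measurable_expR_lincomb.
  by move=> w; exact: expR_ge0.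
exact: integral_expR_ray.
Qed.

(** Common ancestors of the two rays are counted twice in the covariance, and a
    vertex of one ray meets the other ray only in its own generation. *)
Lemma has_mean_expR_rays (x : nat -> R) xi eta n : boundary T xi -> boundary T eta ->
  has_mean (fun w => expR (\sum_(0 <= k < n) x k * Z (xi k.+1) w +
                           \sum_(0 <= k < n) x k * Z (eta k.+1) w))
    (expR (\sum_(0 <= k < n) x k ^+ 2 +
           \sum_(0 <= k < n) x k ^+ 2 * (xi k.+1 == eta k.+1)%:R)).
Proof.
move=> bxi beta; split.
- by apply: measurableT_comp => //; apply: measurable_funD; exact: measurable_lincomb.
- by move=> w; exact: expR_ge0.
pose r := [seq (e, k) | e <- [:: true; false], k <- index_iota 0 n].
pose v (i : bool * nat) := if i.1 then xi i.2.+1 else eta i.2.+1.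
have sumr (F : bool * nat -> R) : \sum_(i <- r) F i =
    \sum_(0 <= k < n) F (true, k) + \sum_(0 <= k < n) F (false, k).
  by rewrite big_allpairs_dep /= !big_cons big_nil addr0.
transitivity (\int[P]_w (expR (\sum_(i <- r) x i.2 * Z (v i) w))%:E)%E.
  by apply: eq_integral => w _; rewrite sumr.
rewrite (integral_expR_gauss hZindep hZgauss _ (fun i => x i.2)); congr (expR _)%:E.
have cross k l : (xi k.+1 == eta l.+1) = (k == l) && (xi k.+1 == eta k.+1).
  case: (eqVneq k l) => [->//|kl] /=; apply/negbTE/eqP => e.
  have := depth_ray k.+1 bxi; rewrite e (depth_ray _ beta) => -[lk].
  by rewrite lk eqxx in kl.
rewrite !sumr.
under eq_bigr => k _ do rewrite sumr /=.
under [X in _ + X]eq_bigr => k _ do rewrite sumr /=.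
have diag (y : nat -> R) k : k \in index_iota 0 n ->
    \sum_(0 <= l < n) x k * x l * ((k == l)%:R * y k) = x k ^+ 2 * y k.
  move=> kn; rewrite -(sum_delta (fun l => x k * x l * y k) (iota_uniq _ _) kn).
  by apply: eq_bigr => l _; rewrite mulrA mulrAC.
have -> : \sum_(0 <= k < n) (\sum_(0 <= l < n) x k * x l * (xi k.+1 == xi l.+1)%:R +
     \sum_(0 <= l < n) x k * x l * (xi k.+1 == eta l.+1)%:R) =
   \sum_(0 <= k < n) (x k ^+ 2 + x k ^+ 2 * (xi k.+1 == eta k.+1)%:R).
  apply: eq_big_seq => k kn; congr (_ + _).
    rewrite -[RHS]mulr1 -(diag (fun=> 1) k kn).
    by apply: eq_bigr => l _; rewrite ray_eqE// mulr1.
  rewrite -(diag (fun k => (xi k.+1 == eta k.+1)%:R) k kn).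
  by apply: eq_bigr => l _; rewrite cross -mulnb natrM.
have -> : \sum_(0 <= k < n) (\sum_(0 <= l < n) x k * x l * (eta k.+1 == xi l.+1)%:R +
     \sum_(0 <= l < n) x k * x l * (eta k.+1 == eta l.+1)%:R) =
   \sum_(0 <= k < n) (x k ^+ 2 * (xi k.+1 == eta k.+1)%:R + x k ^+ 2).
  apply: eq_big_seq => k kn; congr (_ + _).
    rewrite -(diag (fun k => (xi k.+1 == eta k.+1)%:R) k kn).
    apply: eq_bigr => l _; rewrite eq_sym cross eq_sym -natrM mulnb.
    by case: eqVneq => [->|].
  rewrite -[RHS]mulr1 -(diag (fun=> 1) k kn).
  by apply: eq_bigr => l _; rewrite ray_eqE// mulr1.
by rewrite !big_split /=; lra.
Qed.

Section Tilt.
Variables (x : nat -> R) (K : R) (N : nat).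
Hypothesis (K0 : 0 < K).
Hypothesis (hK : forall k, log_degree R T k <= K * ln (Dmin_at R T k.+1)).
Hypothesis (hx : forall m, (m <= N)%N ->
  \sum_(0 <= k < m) x k ^+ 2 <= psum b m / (2 * K)).

Local Notation theta := (flow R hleaf).
Local Notation energy := (fun m => \sum_(0 <= k < m) x k ^+ 2).

Let tilt v w : R :=
  expR (- (energy N / 2)) * expR (\sum_(0 <= k < N) x k * Z (ray hleaf v k.+1) w).

Let mass w : R := \sum_(v <- level_seq T N) theta v * tilt v w.

Let mean_mass : has_mean mass 1.
Proof.
rewrite -(sum_flow hfin hleaf hDmin N).
have H v : has_mean (fun w => theta v * tilt v w) (theta v).
  rewrite -[Y in has_mean _ Y]mulr1; apply: has_meanZ; first exact: flow_ge0.
  have := has_meanZ (expR_ge0 (- (energy N / 2))) (has_mean_expR_ray x N (boundary_ray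
    hleaf v)).
  by rewrite -expRD -mulr_suml addNr expR0.
exact: has_mean_sum.
Qed.

Let common v u m : R := (ray hleaf v m == ray hleaf u m)%:R.

(** The rays agree up to generation m and, m being maximal, nowhere after it
    among the first n generations. *)
Let last_common v u n : exists m, [/\ (m <= n)%N, ray hleaf v m = ray hleaf u m &
  \sum_(0 <= k < n) x k ^+ 2 * common v u k.+1 <= energy m].
Proof.
elim: n => [|n [m [mn vu le]]].
  exists 0%N; rewrite !big_nil; split=> //.
  by rewrite (boundary_ray hleaf v).1 (boundary_ray hleaf u).1.
have [e|ne] := eqVneq (ray hleaf v n.+1) (ray hleaf u n.+1).
  exists n.+1; split=> //; apply: ler_sum => k _.
  by rewrite ler_piMr ?sqr_ge0// /common lern1 leq_b1.
exists m; split=> //; first exact: leqW.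
by rewrite big_nat_recr//= {2}/common (negbTE ne) mulr0 addr0.
Qed.

(** Bounding by the sum over all m makes the second moment linear in the
    indicators of agreement. *)
Let expR_common v u :
  expR (\sum_(0 <= k < N) x k ^+ 2 * common v u k.+1) <=
  \sum_(0 <= m < N.+1) expR (energy m) * common v u m.
Proof.
have [m [mN vu le]] := last_common v u N.
rewrite [leRHS](bigD1_seq m) ?iota_uniq ?mem_index_iota//= {2}/common vu eqxx mulr1.
apply: le_trans (_ : expR (energy m) <= _); first by rewrite ler_expR.
by rewrite lerDl sumr_ge0// => k _; rewrite mulr_ge0 ?expR_ge0.
Qed.

(** Summed against the flow, agreement at generation m has mass at most
    exp (- psum m / K), which by [hx] beats exp (energy m) geometrically. *)
Let second_moment : exists2 m2, has_mean (fun w => mass w ^+ 2) m2 &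
  m2 <= (1 - expR (- (4 * K)^-1))^-1.
Proof.
pose lev := level_seq T N.
exists (\sum_(v <- lev) \sum_(u <- lev) theta v * theta u *
   (expR (- energy N) * expR (energy N + \sum_(0 <= k < N) x k ^+ 2 * common v u
     k.+1))).
  have H v u : has_mean (fun w => theta v * theta u * (expR (- energy N) *
      expR (\sum_(0 <= k < N) x k * Z (ray hleaf v k.+1) w +
            \sum_(0 <= k < N) x k * Z (ray hleaf u k.+1) w)))
    (theta v * theta u * (expR (- energy N) *
      expR (energy N + \sum_(0 <= k < N) x k ^+ 2 * common v u k.+1))).
    apply: has_meanZ; first by rewrite mulr_ge0// flow_ge0.
    apply: has_meanZ; first exact: expR_ge0.
    by apply: has_mean_expR_rays; exact: boundary_ray.
  have -> : (fun w => mass w ^+ 2) = (fun w => \sum_(v <- lev) \sum_(u <- lev)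
      theta v * theta u * (expR (- energy N) *
      expR (\sum_(0 <= k < N) x k * Z (ray hleaf v k.+1) w +
            \sum_(0 <= k < N) x k * Z (ray hleaf u k.+1) w))).
    apply/funext => w; rewrite expr2 /mass mulr_suml; apply: eq_bigr => v _.
    rewrite mulr_sumr; apply: eq_bigr => u _; rewrite mulrACA; congr (_ * _).
    rewrite /tilt mulrACA -!expRD; congr expR; lra.
  by apply: has_mean_sum => v; exact: has_mean_sum.
apply: le_trans (_ : \sum_(v <- lev) \sum_(u <- lev) theta v * theta u *
   (\sum_(0 <= m < N.+1) expR (energy m) * common v u m) <= _).
  apply: ler_sum => v _; apply: ler_sum => u _; apply: ler_wpM2l.
    by rewrite mulr_ge0// flow_ge0.
  by rewrite -expRD addKr expR_common.
have -> : \sum_(v <- lev) \sum_(u <- lev) theta v * theta u *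
     (\sum_(0 <= m < N.+1) expR (energy m) * common v u m) =
   \sum_(0 <= m < N.+1) expR (energy m) *
     (\sum_(v <- lev) theta v * \sum_(u <- lev) theta u * common v u m).
  under eq_bigr => v _ do under eq_bigr => u _ do rewrite mulr_sumr.
  under eq_bigr => v _ do rewrite exchange_big /=.
  rewrite exchange_big /=; apply: eq_bigr => m _; rewrite mulr_sumr.
  apply: eq_bigr => v _; rewrite !mulr_sumr; apply: eq_bigr => u _; ring.
have c0 : 0 < (4 * K)^-1 by rewrite invr_gt0 mulr_gt0.
apply: le_trans (sum_expR_le N.+1 c0).
rewrite big_nat [leRHS]big_nat; apply: ler_sum => m /andP[_]; rewrite ltnS => mN.
apply: le_trans (_ : expR (energy m) * expR (- (psum b m / K)) <= _).
  rewrite ler_wpM2l ?expR_ge0//.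
  apply: le_trans (_ : \sum_(v <- lev) theta v * expR (- (psum b m / K)) <= _).
    apply: ler_sum => v _; rewrite ler_wpM2l ?flow_ge0//.
    have dm : depth (ray hleaf v m) = m by apply: depth_ray; exact: boundary_ray.
    have := flow_le hleaf hDmin (ray hleaf v m) K0 hK.
    rewrite -(sum_flow_below hfin hleaf hDmin (n := N)) dm//.
    by under eq_bigr do rewrite eq_sym.
  by rewrite -mulr_suml (sum_flow hfin hleaf hDmin) mul1r.
rewrite -expRD ler_expR.
have := hx mN; have := psum_ge_nat (log_degree_ge hfin hleaf hDmin) m.
move=> h1 h2; have h3 : psum b m / (2 * K) = (4 * K)^-1 * (2 * psum b m).
  by field; rewrite gt_eqF.
have -> : psum b m / K = (4 * K)^-1 * (4 * psum b m) by field; rewrite gt_eqF.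
rewrite h3 in h2; have : (4 * K)^-1 * m%:R <= (4 * K)^-1 * (2 * psum b m).
  by rewrite ler_wpM2l ?(ltW c0)//; lra.
lra.
Qed.

Let moment_bound : R := (1 - expR (- (4 * K)^-1))^-1.

Let moment_bound_gt0 : 0 < moment_bound.
Proof. by rewrite invr_gt0 subr_gt0 expR_lt1 oppr_lt0 invr_gt0 mulr_gt0. Qed.

(** Outside B every ray sum is at most A, so there the tilted mass is at most the
    mass tilted further by - alpha, times exp A; its mean is exp e.  On B the
    tilted mass is controlled by its second moment and the smallness of B.
    Since the tilted mass has mean 1, exp e cannot be small. *)
Lemma tilted_sum_le (A : R) (B : set Omega) : measurable B ->
  (forall w, ~ B w -> forall v, v \in level_seq T N ->
    \sum_(0 <= k < N) alpha k.+1 * Z (ray hleaf v k.+1) w <= A) ->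
  (P B <= (2 * moment_bound)^-1%:E)%E ->
  \sum_(0 <= k < N) x k * alpha k.+1 <= A + t 0 ^+ 2 / 2 + ln 4.
Proof.
move=> mB hB PB.
have [m2 mean_mass2 m2C] := second_moment.
have PBfin : P B \is a fin_num by rewrite fin_num_measure.
have mean_B : has_mean (\1_B : Omega -> R) (fine (P B)).
  split => [|w|]; [exact: measurable_indic|by rewrite indicE|].
  by rewrite integral_indic// setIT fineK.
pose e := A - \sum_(0 <= k < N) x k * alpha k.+1 +
  (\sum_(0 <= k < N) alpha k.+1 ^+ 2) / 2.
pose L w := \sum_(v <- level_seq T N) theta v * (expR (A - energy N / 2) *
  expR (\sum_(0 <= k < N) (x k - alpha k.+1) * Z (ray hleaf v k.+1) w)).
have mean_L : has_mean L (expR e).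
  rewrite -[expR e]mul1r -(sum_flow hfin hleaf hDmin N) mulr_suml.
  apply: has_mean_sum => v; apply: has_meanZ; first exact: flow_ge0.
  have := has_meanZ (expR_ge0 (A - energy N / 2))
    (has_mean_expR_ray (fun k => x k - alpha k.+1) N (boundary_ray hleaf v)).
  rewrite -expRD; congr has_mean; congr expR.
  have -> : \sum_(0 <= k < N) (x k - alpha k.+1) ^+ 2 / 2 =
      (energy N - 2 * \sum_(0 <= k < N) x k * alpha k.+1 +
       \sum_(0 <= k < N) alpha k.+1 ^+ 2) / 2.
    rewrite -mulr_suml mulr_sumr -sumrB -big_split/=; congr (_ / _).
    by apply: eq_bigr => k _; ring.
  by rewrite /e; lra.
have mean_rhs := has_meanD mean_L (has_meanD
  (has_meanZ (_ : 0 <= (2 * moment_bound)^-1) mean_mass2)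
  (has_meanZ (_ : 0 <= moment_bound / 2) mean_B)).
have := has_mean_le mean_mass (mean_rhs _ _) _.
have C2 : 0 <= (2 * moment_bound)^-1 by rewrite invr_ge0 mulr_ge0// ltW.
have C2' : 0 <= moment_bound / 2 by rewrite divr_ge0// ltW.
move=> /(_ C2 C2') main.
have {main} : 1 <= expR e +
    ((2 * moment_bound)^-1 * m2 + moment_bound / 2 * fine (P B)).
  apply: main => w.
  (* the weight 1 / moment_bound balances the two terms on the right *)
  have amgm : mass w <= (2 * moment_bound)^-1 * mass w ^+ 2 + moment_bound / 2.
    rewrite -subr_ge0 (_ : _ - _ = (2 * moment_bound)^-1 * (mass w - moment_bound) ^+ 2).
      by rewrite mulr_ge0 ?sqr_ge0.
    by field; rewrite gt_eqF.
  have L0 : 0 <= L w by have [_ + _] := mean_L; apply.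
  have [wB|nB] := pselect (B w).
    have -> : \1_B w = 1 :> R by rewrite indicE mem_set.
    lra.
  rewrite indicE memNset//= mulr0 addr0.
  apply: le_trans (_ : L w <= _); last by rewrite lerDl mulr_ge0 ?sqr_ge0.
  rewrite /mass /L big_seq [leRHS]big_seq; apply: ler_sum => v vN.
  rewrite ler_wpM2l ?flow_ge0// /tilt -!expRD ler_expR.
  have := hB w nB v vN.
  have -> : \sum_(0 <= k < N) (x k - alpha k.+1) * Z (ray hleaf v k.+1) w =
     \sum_(0 <= k < N) x k * Z (ray hleaf v k.+1) w -
     \sum_(0 <= k < N) alpha k.+1 * Z (ray hleaf v k.+1) w.
    by rewrite -sumrB; apply: eq_bigr => k _; rewrite mulrBl.
  lra.
have h1 : (2 * moment_bound)^-1 * m2 <= 1 / 2.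
  apply: le_trans (_ : (2 * moment_bound)^-1 * moment_bound <= _);
    first by rewrite ler_wpM2l.
  by rewrite invfM mulfVK ?gt_eqF//; lra.
have h2 : moment_bound / 2 * fine (P B) <= 1 / 4.
  apply: le_trans (_ : moment_bound / 2 * (2 * moment_bound)^-1 <= _).
    by rewrite ler_wpM2l// -lee_fin fineK.
  by rewrite le_eqVlt; apply/orP; left; apply/eqP; field; rewrite gt_eqF.
move=> h3; have : expR (- ln 4) <= expR e.
  by rewrite expRN lnK ?posrE//; lra.
rewrite ler_expR /e.
have : \sum_(0 <= k < N) alpha k.+1 ^+ 2 <= t 0 ^+ 2.
  by have := sum_sqr_le halpha2 N; rewrite big_add1.
lra.
Qed.

End Tilt.

Definition exceed (A : nat) : set Omega :=
  \bigcup_n \bigcup_(v in [set` level_seq T n.+1])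
    [set w | A%:R < \sum_(0 <= k < n.+1) alpha k.+1 * Z (ray hleaf v k.+1) w].

Lemma measurable_exceed A : measurable (exceed A).
Proof.
apply: bigcup_measurable => n _; apply: fin_bigcup_measurable => // v _.
rewrite -[X in measurable X]setTI.
have m := measurable_lincomb (index_iota 0 n.+1) (fun k => alpha k.+1)
  (fun k => ray hleaf v k.+1).
rewrite (_ : [set w | _] = (fun w => \sum_(0 <= k < n.+1)
    alpha k.+1 * Z (ray hleaf v k.+1) w) @^-1` `]A%:R, +oo[%classic).
  exact: m.
by apply/seteqP; split => w /=; rewrite in_itv/= andbT.
Qed.

(** The events decrease in A and their intersection is contained in the event
    that Mstar is infinite. *)
Lemma exceed_small (e : R) : {ae P, forall w, (Mstar alpha Z w < +oo)%E} ->
  0 < e -> exists A, (P (exceed A) <= e%:E)%E.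
Proof.
move=> [Nul [mNul PNul subNul]] e0.
have cap0 : P (\bigcap_A exceed A) = 0%E.
  apply: (subset_measure0 _ mNul _ PNul).
    by apply: bigcap_measurableType => A _; exact: measurable_exceed.
  move=> w capw; apply: subNul => /= Mfin.
  have [n _ [v _ /= ltn]] := capw 0%N I.
  have Mstar_ge m u : ((\sum_(0 <= k < m.+1) alpha k.+1 * Z (ray hleaf u k.+1) w)%:E
      <= Mstar alpha Z w)%E.
    apply: le_ereal_sup_tmp; eexists; first by exists m.+1.
    apply: le_ereal_sup_tmp; eexists.
      by exists (ray hleaf u) => //; exact: boundary_ray.
    by rewrite lee_fin ray_sumE ler_norm.
  have M0 : (0 <= Mstar alpha Z w)%E.
    by apply: le_trans (Mstar_ge n v); rewrite lee_fin ltW.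
  have Mfn : Mstar alpha Z w \is a fin_num by rewrite ge0_fin_numE.
  have [n' _ [v' _ /= lt']] := capw (Num.truncn (fine (Mstar alpha Z w))).+1 I.
  have := Mstar_ge n' v'; rewrite -(fineK Mfn) lee_fin => le'.
  have := lt_le_trans lt' le'; apply/negP; rewrite -leNgt ltW//.
  exact: truncnS_gt.
have nd : {homo exceed : n m / (n <= m)%N >-> (m <= n)%O}.
  move=> n m nm; apply/subsetPset => w [k _ [v vk /= lt]]; exists k => //;
    exists v => //=.
  by apply: le_lt_trans lt; rewrite ler_nat.
have cvg : P (exceed A) @[A --> \oo] --> P (\bigcap_A exceed A).
  apply: nonincreasing_cvg_mu => //.
  - by rewrite ltey_eq fin_num_measure//; exact: measurable_exceed.
  - by move=> A; exact: measurable_exceed.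
  - by apply: bigcap_measurableType => A _; exact: measurable_exceed.
rewrite cap0 in cvg; have [|A /(_ A (leqnn A))] := (cvge0P _).1 cvg e e0.
  by move=> n; exact: measure_ge0.
by exists A.
Qed.

Lemma degree_ratio_bound :
  (ereal_sup [set (ln (Dmax_at R T n) / ln (Dmin_at R T n))%:E
               | n in [set n : nat | (1 <= n)%N]] < +oo)%E ->
  exists2 K : R, 0 < K & forall k, b k <= K * ln (Dmin_at R T k.+1).
Proof.
set E := ereal_sup _ => Efin.
have lnmin k : 0 < ln (Dmin_at R T k.+1).
  by rewrite ln_gt0//; have := Dmin_at_ge2 hleaf hDmin k; lra.
have le_E k : ((b k / ln (Dmin_at R T k.+1))%:E <= E)%E.
  by apply: ereal_sup_ubound; exists k.+1.
have pos : 0 < b 0 / ln (Dmin_at R T 1).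
  by rewrite divr_gt0//; have := log_degree_ge hfin hleaf hDmin 0; lra.
have Efn : E \is a fin_num.
  by rewrite ge0_fin_numE//; apply: le_trans (le_E 0%N); rewrite lee_fin ltW.
exists (fine E).
  by apply: lt_le_trans pos _; rewrite -lee_fin fineK.
by move=> k; rewrite -ler_pdivrMr// -lee_fin fineK.
Qed.

(** With c the square root of 1 / (2 K), the tilt x k is c times the slope
    direction, which [hardy_slope] makes admissible for every n. *)
Lemma entropy_of_bounded :
  (ereal_sup [set (ln (Dmax_at R T n) / ln (Dmin_at R T n))%:E
               | n in [set n : nat | (1 <= n)%N]] < +oo)%E ->
  {ae P, forall w, (Mstar alpha Z w < +oo)%E} ->
  (\sum_(0 <= l <oo) (entropy_term T alpha l)%:E < +oo)%E.
Proof.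
move=> /degree_ratio_bound[K K0 hK] bounded.
have hb := log_degree_ge hfin hleaf hDmin.
pose C := (1 - expR (- (4 * K)^-1))^-1.
have C_gt0 : 0 < C by rewrite invr_gt0 subr_gt0 expR_lt1 oppr_lt0 invr_gt0 mulr_gt0.
have [|A PA] := @exceed_small (2 * C)^-1 bounded; first by rewrite invr_gt0 mulr_gt0.
pose c := Num.sqrt (2 * K)^-1.
have c0 : 0 < c by rewrite sqrtr_gt0 invr_gt0 mulr_gt0.
have c2 : c ^+ 2 = (2 * K)^-1 by rewrite sqr_sqrtr// invr_ge0 mulr_ge0// ltW.
pose slope := slope_sum t b.
pose x k := c * (alpha k.+1 * slope k.+1).
have hx m : \sum_(0 <= k < m) x k ^+ 2 <= psum b m / (2 * K).
  under eq_bigr do rewrite /x exprMn c2.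
  rewrite -mulr_sumr mulrC ler_wpM2r ?invr_ge0 ?mulr_ge0 ?(ltW K0)//.
  apply: le_trans (hardy_slope (tail_norm_ge0 alpha) (tail_norm_rec halpha2) hb m).
  by rewrite lerDl sqr_ge0.
pose B := (A%:R + t 0 ^+ 2 / 2 + ln 4) / c.
have sumB n : \sum_(0 <= k < n.+1) alpha k.+1 ^+ 2 * slope k.+1 <= B.
  rewrite /B ler_pdivlMr//.
  have := @tilted_sum_le x K n.+1 K0 hK (fun m _ => hx m) A%:R _ (measurable_exceed A)
    _ PA.
  move=> H; apply: le_trans (H _).
    by rewrite le_eqVlt mulr_suml; apply/orP; left; apply/eqP; apply: eq_bigr => k _;
      rewrite /x; ring.
  move=> w nw v vn; rewrite leNgt; apply/negP => lt; apply: nw; exists n => //.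
  by exists v.
have entB J : \sum_(0 <= k < J) entropy t b k <= 2 * (B + 1).
  apply: le_trans (_ : 2 * \sum_(0 <= k < J) t k * (rootsum b k.+1 - rootsum b k) <= _).
    rewrite mulr_sumr; apply: ler_sum => k _; rewrite mulrCA ler_wpM2l ?tail_norm_ge0//.
    exact: rootsum_increment_ge.
  rewrite ler_wpM2l//.
  have s0 : 0 <= slope J := slope_sum_ge0 (tail_norm_ge0 alpha) hb J.
  have e0 : 0 < (slope J + 1)^-1 by rewrite invr_gt0; lra.
  (* n is taken so large that the remainder in sum_slope is at most 1 *)
  have [M _ tM] := (@cvgrPdist_lt _ _ _ _ _ _ _).1 (cvg_tail_norm halpha2) _ e0.
  have := sum_slope (tail_norm_ge0 alpha) (tail_norm_rec halpha2) hb (leqW (leq_maxl J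
    M)).
  move=> H; apply: le_trans H _; apply: lerD; first exact: sumB.
  have := tM _ (leqW (leq_maxr J M)); rewrite sub0r normrN ger0_norm ?sqr_ge0//.
  move=> /ltW tle; apply: le_trans (_ : (slope J + 1)^-1 * slope J <= _).
    by rewrite ler_wpM2r.
  by rewrite mulrC ler_pdivrMr; lra.
apply: le_lt_trans (_ : _ <= (2 * (B + 1))%:E)%E _; last by rewrite ltry.
apply: lime_le.
  apply: is_cvg_nneseries => n _ _.
  rewrite lee_fin (entropy_termE hfin hleaf hDmin).
  exact: entropy_ge0 (tail_norm_ge0 alpha) hb n.
apply: nearW => n; rewrite sumEFin lee_fin.
under eq_bigr do rewrite (entropy_termE hfin hleaf hDmin).
exact: entB.
Qed.

(** * Uniform convergence on the boundary *)

Lemma uniform_cvgP (F : nat -> (nat -> T) -> R) (S : (nat -> T) -> R)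
    (D : set (nat -> T)) :
  {uniform D, F @ \oo --> S} <->
  forall e : R, 0 < e -> exists N, forall n, (N <= n)%N ->
    forall xi, D xi -> `|S xi - F n xi| < e.
Proof.
split=> [FS e e0|small P0].
  have : nbhs (S : {uniform` D -> R}) [set h | forall xi, D xi -> `|S xi - h xi| < e].
    apply/uniform_nbhs; exists [set xy | ball xy.1 e xy.2]; split=> //.
    exact: entourage_ball (PosNum e0).
  by move=> /FS [N _ FN]; exists N => n Nn xi Dxi; exact: FN.
move=> /uniform_nbhs [E [entE EP]].
have [e /= e0 ballE] : exists2 e : R, 0 < e & [set xy | ball xy.1 e xy.2] `<=` E.
  by move: entE; rewrite -entourage_ballE.
have [N FN] := small e e0; exists N => // n Nn; apply: EP => xi Dxi.
by apply: ballE; exact: FN.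
Qed.

(** For n <= N the partial sums are bounded by D, a sum over the finitely many
    vertices of the first N generations; later ones differ by at most 2 from
    the N-th. *)
Lemma bounded_of_uniform_cvg w :
  converges_uniformly_on_boundary alpha Z w -> (Mstar alpha Z w < +oo)%E.
Proof.
move=> [S /uniform_cvgP/(_ 1 ltr01)[N SN]].
pose D := \sum_(1 <= k < N.+1) \sum_(v <- level_seq T k) `|alpha k * Z v w|.
have small n xi : (n <= N)%N -> boundary T xi -> `|ray_sum alpha Z 1 n.+1 xi w| <= D.
  move=> nN bxi; apply: le_trans (ler_norm_sum _ _ _) _.
  rewrite /D [leRHS](@big_cat_nat _ _ _ n.+1 1 N.+1)//= -[leLHS]addr0 lerD//;
    last first.
    by apply: sumr_ge0 => k _; apply: sumr_ge0.
  apply: ler_sum => k _; rewrite (bigD1_seq (xi k)) ?uniq_level_seq ?ray_level_seq//=.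
  by rewrite lerDl sumr_ge0.
apply: le_lt_trans (_ : _ <= (D + 2)%:E)%E _; last by rewrite ltry.
apply: ge_ereal_sup => _ [n _ <-]; apply: ge_ereal_sup => _ [xi bxi <-].
rewrite lee_fin; have [nN|/ltnW Nn] := leqP n N.
  by apply: le_trans (small n xi nN bxi) _; rewrite lerDl.
have h1 := SN n Nn xi bxi; have h2 := SN N (leqnn N) xi bxi.
have h3 := small N xi (leqnn N) bxi.
have -> : ray_sum alpha Z 1 n.+1 xi w = ray_sum alpha Z 1 N.+1 xi w +
  (S xi - ray_sum alpha Z 1 N.+1 xi w) - (S xi - ray_sum alpha Z 1 n.+1 xi w) by ring.
apply: le_trans (ler_normB _ _) _; apply: le_trans (lerD (ler_normD _ _) (lexx _)) _.
lra.
Qed.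

(** The event that the tail supremum exceeds e, written as a countable union over
    vertices so that its measurability is visible. *)
Let bad (e : R) (N : nat) : set Omega :=
  \bigcup_(n in [set n | (N <= n)%N]) \bigcup_m \bigcup_(v in [set` level_seq T (n +
    m)])
    [set w | e < `|ray_sum alpha Z n (n + m).+1 (ray hleaf v) w| ^+ 2].

Let measurable_bad e N : measurable (bad e N).
Proof.
apply: bigcup_measurable => n _; apply: bigcup_measurable => m _.
apply: fin_bigcup_measurable => // v _; rewrite -[X in measurable X]setTI.
have mf : measurable_fun setT
    (fun w => `|ray_sum alpha Z n (n + m).+1 (ray hleaf v) w| ^+ 2).
  apply: measurable_funX; apply: measurableT_comp => //.
  exact: measurable_lincomb.
rewrite (_ : [set w | _] = (fun w =>
    `|ray_sum alpha Z n (n + m).+1 (ray hleaf v) w| ^+ 2) @^-1` `]e, +oo[%classic).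
  exact: mf.
by apply/seteqP; split => w /=; rewrite in_itv/= andbT.
Qed.

Let markov_bad e N : 0 < e ->
  (e%:E * P (bad e N) <= \int[P]_w tail_sup alpha Z N w)%E.
Proof.
move=> e0; have -> : (e%:E * P (bad e N) = \int[P]_w (e%:E * (\1_(bad e N) w)%:E))%E.
  rewrite ge0_integralZl_EFin ?integral_indic ?setIT//; last exact: ltW.
  by apply/measurable_EFinP; exact: measurable_indic.
apply: ge0_le_integralT => w; first by rewrite -EFinM lee_fin mulr_ge0// ltW.
rewrite indicE; case: (boolP (w \in bad e N)) => [/set_mem[n Nn [m _ [v _ /= lt]]]|_].
  by rewrite mule1; apply: le_trans (tail_sup_ge m w Nn (boundary_ray hleaf v));
    rewrite lee_fin ltW.
by rewrite mule0 tail_sup_ge0.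
Qed.

(** By the Markov inequality the events [bad e N] have a null intersection over
    N; off these null sets, for e = 1 / (j + 1), the partial sums are uniformly
    Cauchy. *)
Lemma uniform_cvg_of_tail :
  (\int[P]_w tail_sup alpha Z N w)%E @[N --> \oo] --> 0%E ->
  {ae P, forall w, converges_uniformly_on_boundary alpha Z w}.
Proof.
move=> /cvge0P tail.
have tail0 N : (0 <= \int[P]_w tail_sup alpha Z N w)%E.
  by apply: integral_ge0 => w _; exact: tail_sup_ge0.
have null e : 0 < e -> P (\bigcap_N bad e N) = 0%E.
  move=> e0; apply/eqP; rewrite eq_le measure_ge0 andbT.
  have mcap : measurable (\bigcap_N bad e N).
    by apply: bigcap_measurableType => N _; exact: measurable_bad.
  apply/lee_addgt0Pr => f f0; rewrite add0e.
  have [N0 /(_ N0 (leqnn _))] := tail tail0 (e * f) (mulr_gt0 e0 f0).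
  move=> /(le_trans (markov_bad N0 e0)); rewrite EFinM lee_pmul2l// => /(le_trans _);
    apply.
  by apply: le_measure; [exact: mem_set|apply: mem_set;
    exact: measurable_bad|exact: bigcap_inf].
have : P.-negligible (\bigcup_j \bigcap_N bad (j.+1%:R^-1) N).
  apply: negligible_bigcup => j; apply/negligibleP; last by apply: null;
    rewrite invr_gt0.
  by apply: bigcap_measurableType => N _; exact: measurable_bad.
apply: negligibleS => w /= nconv; apply: contrapT => good; apply: nconv.
have cauchy e : 0 < e -> exists N, forall n m xi, (N <= n)%N -> boundary T xi ->
    `|ray_sum alpha Z n (n + m).+1 xi w| <= e.
  move=> e0; pose j := Num.truncn (e ^+ 2)^-1.
  have je : j.+1%:R^-1 <= e ^+ 2.
    rewrite -[leRHS]invrK lef_pV2 ?posrE ?invr_gt0 ?exprn_gt0//.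
    by apply: ltW; exact: truncnS_gt.
  have [N badN] : exists N, ~ bad (j.+1%:R^-1) N w.
    by apply/existsNP => all; apply: good; exists j => // N _; exact: all.
  exists N => n m xi Nn bxi; rewrite -ler_sqr ?nnegrE ?(ltW e0)//.
  apply: le_trans je; rewrite leNgt; apply/negP => lt; apply: badN.
  exists n => //; exists m => //; exists (xi (n + m)%N); first exact: ray_level_seq.
  rewrite /=; congr (_ < `|_| ^+ 2): lt; apply: eq_big_nat => k /andP[_].
  by rewrite ltnS => kn; rewrite (ray_rayE _ bxi).
pose F n xi := ray_sum alpha Z 1 n.+1 xi w.
have F_diff n m xi : (n <= m)%N -> F m xi - F n xi = ray_sum alpha Z n.+1 m.+1 xi w.
  by move=> nm;
    rewrite /F /ray_sum (@big_cat_nat _ _ _ n.+1 1 m.+1)//= [LHS]addrC addKr.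
have F_cauchy e : 0 < e -> exists N, forall n m xi, (N <= n)%N -> (n <= m)%N ->
    boundary T xi -> `|F m xi - F n xi| <= e.
  move=> e0; have [N HN] := cauchy e e0; exists N => n m xi Nn nm bxi.
  rewrite F_diff//; move: nm; rewrite leq_eqVlt => /orP[/eqP <-|nm].
    by rewrite /ray_sum big_geq// normr0 ltW.
  by have := HN n.+1 (m - n.+1)%N xi (leqW Nn) bxi; rewrite subnKC.
have F_cvg xi : boundary T xi -> cvgn (F ^~ xi).
  move=> bxi; apply: cauchy_cvg; apply: cauchy_exP => e e0.
  have e2 : 0 < e / 2 by rewrite divr_gt0.
  have [N HN] := F_cauchy _ e2.
  exists (F N xi); exists N => // n /= Nn.
  rewrite /ball/= distrC; apply: le_lt_trans (HN N n xi (leqnn N) Nn bxi) _; lra.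
exists (fun xi => limn (F ^~ xi)); apply/uniform_cvgP => e e0.
have e2 : 0 < e / 2 by rewrite divr_gt0.
  have [N HN] := F_cauchy _ e2.
exists N => n Nn xi bxi; apply: le_lt_trans (_ : e / 2 < e); last lra.
have lim_d : `|F m xi - F n xi| @[m --> \oo] --> `|limn (F ^~ xi) - F n xi|.
  by apply: cvg_norm; apply: cvgB; [exact: F_cvg|exact: cvg_cst].
rewrite -(cvg_lim _ lim_d)//; apply: limr_le; first by apply/cvg_ex; eexists;
  exact: lim_d.
by exists n => // m /= nm; exact: HN.
Qed.

End GaussianTree.

Theorem theorem1p7 (R : realType) (T : rooted_tree)
    (hfin : locally_finite T) (hleaf : no_leaves T)
    (hDmin : 2 <= Dmin R T)
    (hratio : (ereal_sup [set (ln (Dmax_at R T n) / ln (Dmin_at R T n))%:E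
                            | n in [set n : nat | (1 <= n)%N]] < +oo)%E)
    (alpha : nat -> R)
    (halpha0 : forall k : nat, (1 <= k)%N -> 0 <= alpha k)
    (halpha2 : (\sum_(1 <= k <oo) (alpha k ^+ 2)%:E < +oo)%E)
    (d : measure_display) (Omega : measurableType d)
    (P : probability Omega R) (Z : T -> {RV P >-> R})
    (hZindep : mutually_independent Z)
    (hZgauss : forall v : T, standard_gaussian (Z v)) :
  [<-> {ae P, forall w, (Mstar alpha Z w < +oo)%E};
       (\int[P]_w tail_sup alpha Z N w)%E @[N --> \oo] --> 0%E;
       {ae P, forall w, converges_uniformly_on_boundary alpha Z w};
       (\sum_(0 <= l <oo) (entropy_term T alpha l)%:E < +oo)%E].
Proof.
have bounded_entropy := entropy_of_bounded hfin hleaf hDmin halpha2 hZindep hZgauss hratio.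
have entropy_tail := tail_of_entropy hfin hleaf hDmin halpha2 hZindep hZgauss.
have tail_uniform := @uniform_cvg_of_tail _ T hfin hleaf alpha _ _ P Z.
have uniform_bounded : {ae P, forall w, converges_uniformly_on_boundary alpha Z w} ->
    {ae P, forall w, (Mstar alpha Z w < +oo)%E}.
  by apply: filterS => w; exact: bounded_of_uniform_cvg.
tfae.
- by move=> /bounded_entropy/entropy_tail.
- exact: tail_uniform.
- by move=> /uniform_bounded/bounded_entropy.
- by move=> /entropy_tail/tail_uniform/uniform_bounded.
Qed.
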